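(* Let $f_i\in\Gamma_0(\mathbb{R}^{n_i})$, $\alpha_i>0$ for $i=1,\dots,s$ and $\beta>0$. Assume that problem $$\min\Big\{\sum_{i=1}^s f_i(x_i):\ \sum_{i=1}^s A_ix_i=b,\ x_i\in\mathbb{R}^{n_i}\Big\}\qquad(\star)$$ has at least one solution and that $b\in A\big(\mathrm{ri}(\mathrm{dom}(\sum_{i=1}^s f_i))\big)$. Let $\mathcal{M}=\{M_0,M_1,M_2\}$ be a set of real $(n+m)\times(n+m)$ matrices such that $T_{\mathcal{M}}$ is well-defined. For given points $v^0,v^1\in\mathbb{R}^{n+m}$, let $\{v^k=(x^k,y^k)\}_{k\in\mathbb{N}}$, $x^k\in\mathbb{R}^n$, $y^k\in\mathbb{R}^m$, be generated by $$v^{k+1}=\mathcal{T}\big((E-R^{-1}M_0)v^{k+1}+R^{-1}M_1v^k+R^{-1}M_2v^{k-1}\big),\qquad k\ge 1.$$ If $\mathcal{M}$ satisfies Condition-M, then the sequence $\{v^k\}$ converges to a fixed-point of $\mathcal{T}\circ E$, and $\{x^k\}$ converges to a solution of problem $(\star)$.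
   Context: $s,m,n_1,\dots,n_s$ are positive integers, $n=\sum_i n_i$, $\mathbb{R}^n=\mathbb{R}^{n_1}\times\cdots\times\mathbb{R}^{n_s}$. $\Gamma_0(\mathbb{R}^d)$: proper lower semicontinuous convex functions $\mathbb{R}^d\to\mathbb{R}\cup\{+\infty\}$. $A_i$ is a real $m\times n_i$ matrix, $A=[A_1\ \cdots\ A_s]$, $b\in\mathbb{R}^m$, $C=\{b\}$, $\iota_C$ the indicator function of $C$ ($0$ on $C$, $+\infty$ elsewhere), $\varphi^*(y)=\sup_x\{\langle x,y\rangle-\varphi(x)\}$ the conjugate, $\mathrm{prox}_\varphi(x)=\mathrm{argmin}_u\{\frac12\|u-x\|_2^2+\varphi(u)\}$. $\sum_i f_i$ denotes $x\mapsto\sum_i f_i(x_i)$ on $\mathbb{R}^n$; $\mathrm{ri}$ is relative interior. For $v=(x_1,\dots,x_s,y)\in\mathbb{R}^{n+m}$: $\mathcal{T}(v)=(\mathrm{prox}_{\frac{\alpha_1}{\beta}f_1}(x_1),\dots,\mathrm{prox}_{\frac{\alpha_s}{\beta}f_s}(x_s),\mathrm{prox}_{\beta\iota_C^*}(y))$. $P=\mathrm{diag}(\frac{\beta}{\alpha_1}I_{n_1},\dots,\frac{\beta}{\alpha_s}I_{n_s})$, $R=\mathrm{diag}(P,\frac1\beta I_m)$, $E=\begin{bmatrix}I&-P^{-1}A^\top\\ \beta A&I\end{bmatrix}$. $T_{\mathcal{M}}$ is the map sending $(u_1,u_2)\in\mathbb{R}^{n+m}\times\mathbb{R}^{n+m}$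 to the $w\in\mathbb{R}^{n+m}$ satisfying $w=\mathcal{T}((E-R^{-1}M_0)w+R^{-1}M_1u_1+R^{-1}M_2u_2)$; it is called well-defined if for every $(u_1,u_2)$ there is exactly one such $w$. Condition-M for a set $\{M_0,M_1,M_2\}$ of $d\times d$ real matrices: (i) $M_0=M_1+M_2$; (ii) $H:=M_0+M_2$ is symmetric positive definite; (iii) $\|H^{-1/2}M_2H^{-1/2}\|_2<\frac12$, where $\|\cdot\|_2$ is the largest singular value. *)

(* Defs.v *)
From HB Require Import structures.
From mathcomp Require Import all_boot all_order all_algebra.
From mathcomp Require Import all_classical all_reals all_analysis.

Set Implicit Arguments.
Unset Strict Implicit.
Unset Printing Implicit Defensive.

Import Order.TTheory GRing.Theory Num.Theory.
Import numFieldNormedType.Exports.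

Local Open Scope classical_set_scope.
Local Open Scope ring_scope.

Definition dotv (R : realType) (d : nat) (x y : 'cV[R]_d) : R :=
  (x^T *m y) 0 0.

Definition norm2 (R : realType) (d : nat) (x : 'cV[R]_d) : R :=
  Num.sqrt (dotv x x).

Definition effdom (R : realType) (d : nat) (f : 'cV[R]_d -> \bar R) :
    set 'cV[R]_d :=
  [set x | (f x < +oo)%E].

Definition proper (R : realType) (d : nat) (f : 'cV[R]_d -> \bar R) : Prop :=
  (forall x, f x != -oo%E) /\ effdom f !=set0.

Definition econvex (R : realType) (d : nat) (f : 'cV[R]_d -> \bar R) : Prop :=
  forall (x y : 'cV[R]_d) (t : R), 0 < t < 1 ->
    (f (t *: x + (1 - t) *: y)%R <= t%:E * f x + (1 - t)%:E * f y)%E.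

Definition Gamma0 (R : realType) (d : nat) (f : 'cV[R]_d -> \bar R) : Prop :=
  [/\ proper f, lower_semicontinuous f & econvex f].

Definition indicator (R : realType) (d : nat) (C : set 'cV[R]_d)
    (x : 'cV[R]_d) : \bar R :=
  if x \in C then 0%E else +oo%E.

Definition fconj (R : realType) (d : nat) (f : 'cV[R]_d -> \bar R)
    (y : 'cV[R]_d) : \bar R :=
  ereal_sup [set ((dotv x y)%:E - f x)%E | x in [set: 'cV[R]_d]].

Definition prox_argmin (R : realType) (d : nat) (f : 'cV[R]_d -> \bar R)
    (x : 'cV[R]_d) : set 'cV[R]_d :=
  [set p | forall u : 'cV[R]_d,
     ((2^-1 * norm2 (p - x) ^+ 2)%:E + f p <=
      (2^-1 * norm2 (u - x) ^+ 2)%:E + f u)%E].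

(* The argmin is a singleton when [f] is in [Gamma0]; the default value [0] is
   only returned when it is empty. *)
Definition prox (R : realType) (d : nat) (f : 'cV[R]_d -> \bar R)
    (x : 'cV[R]_d) : 'cV[R]_d :=
  xget 0 (prox_argmin f x).

Definition affine_set (R : realType) (d : nat) (S : set 'cV[R]_d) : Prop :=
  forall (x y : 'cV[R]_d) (t : R), S x -> S y -> S (t *: x + (1 - t) *: y).

Definition affine_hull (R : realType) (d : nat) (S : set 'cV[R]_d) :
    set 'cV[R]_d :=
  smallest (@affine_set R d) S.

Definition relint (R : realType) (d : nat) (S : set 'cV[R]_d) :
    set 'cV[R]_d :=
  [set x | affine_hull S x /\
     exists2 V : set 'cV[R]_d, nbhs x V & V `&` affine_hull S `<=` S].

Definition posdefmx (R : realType) (d : nat) (H : 'M[R]_d) : Prop :=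
  H^T = H /\ forall x : 'cV[R]_d, x != 0 -> 0 < dotv x (H *m x).

(* For positive definite [H], exactly one matrix satisfies the predicate. *)
Definition sqrtmx (R : realType) (d : nat) (H : 'M[R]_d) : 'M[R]_d :=
  xget 0 [set S : 'M[R]_d | posdefmx S /\ S *m S = H].

Definition invsqrtmx (R : realType) (d : nat) (H : 'M[R]_d) : 'M[R]_d :=
  invmx (sqrtmx H).

Definition singular_values (R : realType) (d : nat) (M : 'M[R]_d) : set R :=
  [set Num.sqrt l | l in [set l : R | eigenvalue (M^T *m M) l]].

(* For [0 < d] this supremum is over a finite nonempty set, so it is the
   largest singular value. *)
Definition spectral_norm (R : realType) (d : nat) (M : 'M[R]_d) : R :=
  sup (singular_values M).

Definition condition_M (R : realType) (d : nat) (M0 M1 M2 : 'M[R]_d) : Prop :=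
  let H := M0 + M2 in
  [/\ M0 = M1 + M2,
      posdefmx H &
      spectral_norm (invsqrtmx H *m M2 *m invsqrtmx H) < 2^-1].

(* R^n = R^(n_1) x ... x R^(n_s) is the type of column vectors of size
   \sum_i n_ i, and [submxcol x i] is the block x_i of [x]. *)

Definition sumf (R : realType) (s : nat) (n_ : 'I_s -> nat)
    (f : forall i : 'I_s, 'cV[R]_(n_ i) -> \bar R)
    (x : 'cV[R]_(\sum_(i < s) n_ i)%N) : \bar R :=
  (\sum_(i < s) f i (submxcol x i))%E.

Definition feasible (R : realType) (s m : nat) (n_ : 'I_s -> nat)
    (A_ : forall i : 'I_s, 'M[R]_(m, n_ i)) (b : 'cV[R]_m)
    (x : 'cV[R]_(\sum_(i < s) n_ i)%N) : Prop :=
  \sum_(i < s) A_ i *m submxcol x i = b.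

Definition is_solution (R : realType) (s m : nat) (n_ : 'I_s -> nat)
    (f : forall i : 'I_s, 'cV[R]_(n_ i) -> \bar R)
    (A_ : forall i : 'I_s, 'M[R]_(m, n_ i)) (b : 'cV[R]_m)
    (x : 'cV[R]_(\sum_(i < s) n_ i)%N) : Prop :=
  feasible A_ b x /\
  forall z : 'cV[R]_(\sum_(i < s) n_ i)%N,
    feasible A_ b z -> (sumf f x <= sumf f z)%E.

Definition Amx (R : realType) (s m : nat) (n_ : 'I_s -> nat)
    (A_ : forall i : 'I_s, 'M[R]_(m, n_ i)) : 'M[R]_(m, \sum_(i < s) n_ i) :=
  \mxrow_(i < s) A_ i.

Definition Pmx (R : realType) (s : nat) (n_ : 'I_s -> nat)
    (alpha : 'I_s -> R) (beta : R) : 'M[R]_(\sum_(i < s) n_ i)%N :=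
  \mxdiag_(i < s) ((beta / alpha i)%:M : 'M[R]_(n_ i)).

Definition Rmx (R : realType) (s : nat) (n_ : 'I_s -> nat) (m : nat)
    (alpha : 'I_s -> R) (beta : R) : 'M[R]_(\sum_(i < s) n_ i + m)%N :=
  block_mx (Pmx n_ alpha beta) 0 0 (beta^-1)%:M.

Definition Emx (R : realType) (s m : nat) (n_ : 'I_s -> nat)
    (A_ : forall i : 'I_s, 'M[R]_(m, n_ i)) (alpha : 'I_s -> R) (beta : R) :
    'M[R]_(\sum_(i < s) n_ i + m)%N :=
  block_mx 1%:M (- (invmx (Pmx n_ alpha beta) *m (Amx A_)^T))
           (beta *: Amx A_) 1%:M.

Definition Tmap (R : realType) (s m : nat) (n_ : 'I_s -> nat)
    (f : forall i : 'I_s, 'cV[R]_(n_ i) -> \bar R) (b : 'cV[R]_m)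
    (alpha : 'I_s -> R) (beta : R) (v : 'cV[R]_(\sum_(i < s) n_ i + m)%N) :
    'cV[R]_(\sum_(i < s) n_ i + m)%N :=
  col_mx
    (\mxcol_(i < s)
       prox (fun x => ((alpha i / beta)%:E * f i x)%E) (submxcol (usubmx v) i))
    (prox (fun y => (beta%:E * fconj (indicator [set b]) y)%E) (dsubmx v)).

(* The graph of T_M: [TM_rel ... u1 u2 w] means w = T_M(u1, u2). *)
Definition TM_rel (R : realType) (s m : nat) (n_ : 'I_s -> nat)
    (f : forall i : 'I_s, 'cV[R]_(n_ i) -> \bar R)
    (A_ : forall i : 'I_s, 'M[R]_(m, n_ i)) (b : 'cV[R]_m)
    (alpha : 'I_s -> R) (beta : R)
    (M0 M1 M2 : 'M[R]_(\sum_(i < s) n_ i + m)%N)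
    (u1 u2 w : 'cV[R]_(\sum_(i < s) n_ i + m)%N) : Prop :=
  let Rinv := invmx (Rmx n_ m alpha beta) in
  w = Tmap f b alpha beta
        ((Emx A_ alpha beta - Rinv *m M0) *m w
         + Rinv *m M1 *m u1 + Rinv *m M2 *m u2).

Definition TM_well_defined (R : realType) (s m : nat) (n_ : 'I_s -> nat)
    (f : forall i : 'I_s, 'cV[R]_(n_ i) -> \bar R)
    (A_ : forall i : 'I_s, 'M[R]_(m, n_ i)) (b : 'cV[R]_m)
    (alpha : 'I_s -> R) (beta : R)
    (M0 M1 M2 : 'M[R]_(\sum_(i < s) n_ i + m)%N) : Prop :=
  forall u1 u2 : 'cV[R]_(\sum_(i < s) n_ i + m)%N,
    exists! w : 'cV[R]_(\sum_(i < s) n_ i + m)%N,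
      TM_rel f A_ b alpha beta M0 M1 M2 u1 u2 w.

(* Main.v *)
Require Import Defs.
From HB Require Import structures.
From mathcomp Require Import all_boot all_order all_algebra.
From mathcomp Require Import all_classical all_reals all_analysis.
From mathcomp Require Import ring lra.
Import Order.TTheory GRing.Theory Num.Theory.
Import numFieldNormedType.Exports.
Local Open Scope classical_set_scope.
Local Open Scope ring_scope.
Set Implicit Arguments.
Unset Strict Implicit.
Unset Printing Implicit Defensive.

(** Write [v = (x, y)] and [F = sum_i f_i].  The optimality conditions of the
    constrained problem are [- A^T y] in the subdifferential of [F] at [x],
    together with [A x = b].  Equivalently [0] belongs to [G(v)], where [G] is
    the subdifferential of [(x, y) |-> F x + <b, y>] minus the skew matrix
    [S = (0, - A^T; A, 0)]; the relation [kkt v g] says that [g] lies in [G(v)].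
    This relation is monotone, because [S] contributes nothing to
    [<g - h, v - w>], and it has a closed graph.  A proximity operator inverts
    the identity plus a scaled subdifferential, and [E = 1 + R^-1 S], so
    [T(w + R^-1 (S w + g)) = w] exactly when [kkt w g] ([Tmap_fixed]).  Hence the
    fixed points of [T o E] are the zeros of [G], whose [x]-parts solve the
    problem ([kkt_solution]).  Zeros exist ([kkt_exists]): a solution of the
    problem has a Lagrange multiplier under the relative interior condition
    ([exists_multiplier]).

    By the same equivalence, and since [M0 = M1 + M2], each step of the iteration
    reads, with [d_k = v_k - v_{k-1}] and [H = M0 + M2],
    [M2 d_{k+1} - M2 d_k - H d_{k+1}] belongs to [G(v_{k+1})]
    ([iteration_kkt]).  Pairing this by monotonicity with a zero [w] shows that
    [|v_k - w|_H^2 - 2 <M2 d_k, v_k - w> + q |d_k|_H^2] does not increase, with a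
    loss of at least [(1 - 2 q) |d_{k+1}|_H^2] at each step, as soon as
    [2 <M2 a, c> <= q (|a|_H^2 + |c|_H^2)].  Condition-M provides such a [q]
    below [1/2] ([spectral_bilinear_bound]).  Consequently the sequence is bounded
    and its steps tend to zero; a cluster point is a zero of [G] by closedness;
    and the same quantity, now formed with this zero, is nonincreasing and has
    values arbitrarily close to [0], so the whole sequence converges
    ([reflected_iteration_converges]).

    The spectral bound is obtained from Rayleigh quotients: a maximizer on the
    unit sphere is an eigenvector ([rayleigh]), and removing eigenvectors one by
    one produces the positive definite square root ([psdmx_sqrt]). *)

(** * The Euclidean inner product *)

Section InnerProduct.
Context {R : realType} {d : nat}.
Implicit Types (x y z : 'cV[R]_d) (a : R).

Lemma dotvE x y : dotv x y = \sum_i x i 0 * y i 0.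
Proof. by rewrite /dotv mxE; apply: eq_bigr => i _; rewrite mxE. Qed.

Lemma dotvC x y : dotv x y = dotv y x.
Proof. by rewrite !dotvE; apply: eq_bigr => i _; rewrite mulrC. Qed.

Lemma dotvDl x y z : dotv (x + y) z = dotv x z + dotv y z.
Proof. by rewrite /dotv linearD mulmxDl mxE. Qed.

Lemma dotvNl x y : dotv (- x) y = - dotv x y.
Proof. by rewrite /dotv linearN mulNmx mxE. Qed.

Lemma dotvZl a x y : dotv (a *: x) y = a * dotv x y.
Proof. by rewrite /dotv linearZ -scalemxAl mxE. Qed.

Lemma dotvDr x y z : dotv x (y + z) = dotv x y + dotv x z.
Proof. by rewrite dotvC dotvDl !(dotvC x). Qed.

Lemma dotvNr x y : dotv x (- y) = - dotv x y.
Proof. by rewrite dotvC dotvNl dotvC. Qed.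

Lemma dotvZr a x y : dotv x (a *: y) = a * dotv x y.
Proof. by rewrite dotvC dotvZl dotvC. Qed.

Lemma dotv0l x : dotv 0 x = 0.
Proof. by rewrite -(scale0r 0) dotvZl mul0r. Qed.

Lemma dotv0r x : dotv x 0 = 0.
Proof. by rewrite dotvC dotv0l. Qed.

Definition dotv_lin :=
  (dotvDl, dotvDr, dotvNl, dotvNr, dotvZl, dotvZr, dotv0l, dotv0r).

Lemma dotv_ge0 x : 0 <= dotv x x.
Proof. by rewrite dotvE sumr_ge0 // => i _; rewrite -expr2 sqr_ge0. Qed.

Lemma sqr_coord_le_dotv x i : x i 0 ^+ 2 <= dotv x x.
Proof.
rewrite dotvE (bigD1 i) //= -expr2 lerDl sumr_ge0 // => j _.
by rewrite -expr2 sqr_ge0.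
Qed.

Lemma dotv_eq0 x : (dotv x x == 0) = (x == 0).
Proof.
apply/eqP/eqP => [x0|->]; last exact: dotv0l.
apply/colP => i; rewrite mxE; apply/eqP; rewrite -sqrf_eq0.
by rewrite eq_le sqr_ge0 -x0 sqr_coord_le_dotv.
Qed.

Lemma dotv_gt0 x : (0 < dotv x x) = (x != 0).
Proof. by rewrite lt_def dotv_eq0 dotv_ge0 andbT. Qed.

Lemma norm2_sqr x : norm2 x ^+ 2 = dotv x x.
Proof. by rewrite /norm2 sqr_sqrtr // dotv_ge0. Qed.

Lemma cauchy_schwarz x y : dotv x y ^+ 2 <= dotv x x * dotv y y.
Proof.
have [->|y0] := eqVneq y 0; first by rewrite !dotv_lin expr0n mulr0.
have yy : 0 < dotv y y by rewrite dotv_gt0.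
have := dotv_ge0 (dotv y y *: x - dotv x y *: y).
rewrite !dotv_lin (dotvC y x) => h.
have : 0 <= dotv y y * (dotv x x * dotv y y - dotv x y ^+ 2).
  by apply: (le_trans h); rewrite le_eqVlt; apply/orP; left; apply/eqP; ring.
by rewrite pmulr_rge0 // subr_ge0.
Qed.

Lemma dotvD_sqr_le x y : dotv (x + y) (x + y) <= 2 * (dotv x x + dotv y y).
Proof.
have := dotv_ge0 (x - y); rewrite !dotv_lin (dotvC y x); lra.
Qed.

Lemma nbhs_dotv x (V : set 'cV[R]_d) : nbhs x V ->
  exists2 e, 0 < e & forall z, dotv (z - x) (z - x) < e -> V z.
Proof.
move=> /nbhs_ballP[e /= e0 eV]; exists (e ^+ 2); first by rewrite exprn_gt0.
move=> z zx; apply: eV; rewrite mx_norm_ball /ball_ /=.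
rewrite /Num.norm/= mx_normrE; apply/bigmax_ltP; split=> // -[i j] _ /=.
rewrite ord1 -(@ltr_pXn2r _ 2) ?nnegrE ?normr_ge0 //; last exact: ltW.
rewrite real_normK ?num_real //.
apply: le_lt_trans zx; apply: le_trans (sqr_coord_le_dotv _ i) _.
by rewrite -opprB dotvNl dotvNr opprK.
Qed.

End InnerProduct.

Lemma dotv_mulmxl (R : realType) m n (M : 'M[R]_(m, n)) x y :
  dotv (M *m x) y = dotv x (M^T *m y).
Proof. by rewrite /dotv trmx_mul mulmxA. Qed.

Lemma dotv_mulmxr (R : realType) m n (M : 'M[R]_(m, n)) x y :
  dotv x (M *m y) = dotv (M^T *m x) y.
Proof. by rewrite dotv_mulmxl trmxK. Qed.

Lemma dotv_col_mx (R : realType) m n (x1 y1 : 'cV[R]_m) (x2 y2 : 'cV[R]_n) :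
  dotv (col_mx x1 x2) (col_mx y1 y2) = dotv x1 y1 + dotv x2 y2.
Proof. by rewrite /dotv tr_col_mx mul_row_col mxE. Qed.

Lemma dotv_usubmx (R : realType) m n (x : 'cV[R]_(m + n)) :
  dotv (usubmx x) (usubmx x) <= dotv x x.
Proof. by rewrite -[x in leRHS]vsubmxK dotv_col_mx lerDl dotv_ge0. Qed.

Lemma dotv_mxcol (R : realType) s (n_ : 'I_s -> nat)
    (x y : 'cV[R]_(\sum_(i < s) n_ i)%N) :
  dotv x y = \sum_i dotv (submxcol x i) (submxcol y i).
Proof.
rewrite -{1}[x]submxcolK -{1}[y]submxcolK /dotv tr_mxcol mul_mxrow_mxcol summxE.
by [].
Qed.

Lemma dotv_submxcol (R : realType) s (n_ : 'I_s -> nat)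
    (x : 'cV[R]_(\sum_(i < s) n_ i)%N) i :
  dotv (submxcol x i) (submxcol x i) <= dotv x x.
Proof.
by rewrite dotv_mxcol (bigD1 i) //= lerDl sumr_ge0 // => j _; exact: dotv_ge0.
Qed.

Lemma dotv_dsubmx (R : realType) m n (x : 'cV[R]_(m + n)) :
  dotv (dsubmx x) (dsubmx x) <= dotv x x.
Proof. by rewrite -[x in leRHS]vsubmxK dotv_col_mx lerDr dotv_ge0. Qed.

Lemma usubmxB (R : realType) m n (x y : 'cV[R]_(m + n)) :
  usubmx (x - y) = usubmx x - usubmx y.
Proof. exact: linearB. Qed.

Lemma dsubmxB (R : realType) m n (x y : 'cV[R]_(m + n)) :
  dsubmx (x - y) = dsubmx x - dsubmx y.
Proof. exact: linearB. Qed.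

Lemma dotv_split (R : realType) m n (x y : 'cV[R]_(m + n)) :
  dotv x y = dotv (usubmx x) (usubmx y) + dotv (dsubmx x) (dsubmx y).
Proof. by rewrite -dotv_col_mx !vsubmxK. Qed.

(** * Topology of column vectors *)

Lemma dotv_cvg (R : realType) d (u : nat -> 'cV[R]_d) w :
  (forall e, 0 < e ->
    exists N, forall k, (N <= k)%N -> dotv (u k - w) (u k - w) < e) ->
  u @ \oo --> w.
Proof.
move=> cu V /nbhs_dotv[e e0 eV]; have [N hN] := cu e e0.
by exists N => // k /hN; exact: eV.
Qed.

Lemma continuous_dotv_mulmx (R : realType) e1 e2 (T : topologicalType) (L : 'M[R]_(e2, e1))
  (f : T -> 'cV[R]_e1) (g : T -> 'cV[R]_e2) :
  continuous f -> continuous g -> continuous (fun t => dotv (g t) (L *m f t)).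
Proof.
move=> cf cg.
have coord e (h : T -> 'cV[R]_e) i : continuous h -> continuous (fun t => h t i 0).
  move=> ch t; apply: (@continuous_comp _ _ _ h (fun v : 'cV[R]_e => v i 0)).
    exact: ch.
  exact: coord_continuous.
have sumc (I : finType) (F : I -> T -> R) : (forall i, continuous (F i)) ->
    continuous (fun t => \sum_i F i t).
  move=> cF; elim: (index_enum I) => [|i r IH].
    by under eq_fun do rewrite big_nil; move=> t; exact: cvg_cst.
  by under eq_fun do rewrite big_cons; move=> t; apply: cvgD; [exact: cF|exact: IH].
under eq_fun do rewrite dotvE.
apply: (sumc _ (fun i t => g t i 0 * (L *m f t) i 0)) => i t.
apply: cvgM; first exact: coord.
under eq_fun do rewrite mxE; rewrite mxE.
apply: (sumc _ (fun j t => L i j * f t j 0)) => j {}t.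
by apply: cvgM; [exact: cvg_cst | exact: coord].
Qed.

Lemma continuous_dotv (R : realType) d (T : topologicalType) (f g : T -> 'cV[R]_d) :
  continuous f -> continuous g -> continuous (fun t => dotv (f t) (g t)).
Proof.
move=> cf cg; rewrite [X in continuous X](_ : _ = fun t => dotv (f t) (1%:M *m g t)).
  exact: continuous_dotv_mulmx.
by apply/funext => t; rewrite mul1mx.
Qed.

Lemma continuous_trmx (T : topologicalType) m n : continuous (@trmx T m n).
Proof.
move=> M A [P MP sPA]; exists (fun i j => P j i) => [i j|N PN].
  by have := MP j i; rewrite mxE.
by apply: sPA => i j; rewrite mxE; apply: PN.
Qed.

Section Compactness.
Context {R : realType} {d : nat}.

(** Heine-Borel for column vectors, from the compactness of boxes of row vectors
    by transposition. *)
Lemma dotv_compact (K : set 'cV[R]_d) (x : 'cV[R]_d) (B : R) :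
  closed K -> (forall z, K z -> dotv (z - x) (z - x) <= B) -> compact K.
Proof.
move=> Kcl KB.
(* [B + 1] exceeds the square root of [B]. *)
pose c := B + 1 + `|x|.
have box : compact (trmx @` [set v : 'rV[R]_d | forall i, v 0 i \in `[- c, c]]).
  apply: continuous_compact.
    by apply: continuous_subspaceT => M; exact: continuous_trmx.
  apply: (@rV_compact _ _ (fun=> `[- c, c]%classic)) => _.
  exact: segment_compact.
apply: (subclosed_compact Kcl box) => z Kz; exists z^T; last exact: trmxK.
move=> i /=; rewrite mxE in_itv /= -ler_norml.
have -> : z i 0 = (z - x) i 0 + x i 0 by rewrite !mxE subrK.
apply: le_trans (ler_normD _ _) _; apply: lerD; last first.
  rewrite [leRHS]/Num.norm/= mx_normrE; apply/bigmax_geP; right => /=.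
  by exists (i, 0).
have := sqr_coord_le_dotv (z - x) i; have := KB _ Kz.
move: (dotv _ _) ((z - x) i 0) => D a DB aD.
have {DB aD}h : a ^+ 2 <= B by exact: le_trans aD DB.
have [a0|a0] := ger0P a; nra.
Qed.

Lemma continuous_translate (x : 'cV[R]_d) : continuous (fun z : 'cV[R]_d => z - x).
Proof. by move=> z; exact: (cvgB cvg_id (cvg_cst x)). Qed.

Lemma continuous_sqr_dist (x : 'cV[R]_d) :
  continuous (fun z : 'cV[R]_d => dotv (z - x) (z - x)).
Proof. by apply: continuous_dotv; exact: continuous_translate. Qed.

Lemma closed_ball_dotv (x : 'cV[R]_d) (B : R) :
  closed [set z | dotv (z - x) (z - x) <= B].
Proof.
apply: (@preimage_closed _ _ (fun z : 'cV[R]_d => dotv (z - x) (z - x)) [set y | y <= B]).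
  by move=> y _; exact: continuous_sqr_dist.
exact: closed_le.
Qed.

Lemma ball_dotv_compact (x : 'cV[R]_d) (B : R) :
  compact [set z | dotv (z - x) (z - x) <= B].
Proof. by apply: (@dotv_compact _ x B) => //; exact: closed_ball_dotv. Qed.

(** Bolzano-Weierstrass; a cluster point is enough in what follows, so no
    subsequence is extracted. *)
Lemma bounded_cluster (u : nat -> 'cV[R]_d) (x : 'cV[R]_d) (B : R) :
  (forall k, dotv (u k - x) (u k - x) <= B) ->
  exists w, forall e, 0 < e -> forall N,
    exists2 k, (N <= k)%N & dotv (u k - w) (u k - w) < e.
Proof.
move=> uB; have := @ball_dotv_compact x B (u @ \oo) _ _.
case=> [|w [_ clw]]; first by exists 0%N => // k _; exact: uB.
exists w => e e0 N.
have uN : (u @ \oo) (u @` [set k | (N <= k)%N]).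
  by exists N => // k Nk; exists k.
have we : nbhs w [set z | dotv (z - w) (z - w) < e].
  apply: (cvgr_lt _ (@continuous_sqr_dist w w)).
  by rewrite subrr dotv0l.
by have [_ [[k Nk <-] ke]] := clw _ _ uN we; exists k.
Qed.

End Compactness.

Lemma lt_ereal_real (R : realType) (x y : \bar R) :
  (x < y)%E -> exists a : R, (x < a%:E < y)%E.
Proof.
case: x y => [x| |] [y| |] //=; rewrite ?lte_fin => h.
- by exists ((x + y) / 2); rewrite !lte_fin; apply/andP; split; lra.
- by exists (x + 1); rewrite lte_fin ltrDl ltr01 ltry.
- by exists (y - 1); rewrite ltNyr lte_fin gtrDl ltrN10.
- by exists 0; rewrite ltNyr ltry.
Qed.

(** The sublevel sets just above the infimum form a filter base, and lower
    semicontinuity makes any of its cluster points a minimizer. *)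
Lemma lsc_compact_min (R : realType) (T : topologicalType) (K : set T)
    (f : T -> \bar R) :
  lower_semicontinuous f -> compact K -> K !=set0 ->
  exists2 x, K x & forall z, K z -> (f x <= f z)%E.
Proof.
move=> lscf cK [z0 Kz0]; pose l := ereal_inf (f @` K).
have lf z : K z -> (l <= f z)%E by move=> Kz; apply: ereal_inf_lbound; exists z.
have [ly|lNy] := eqVneq l +oo%E; last have {}lNy : (l < +oo)%E by rewrite ltey.
  by exists z0 => // z /lf; rewrite ly leye_eq => /eqP ->; rewrite leey.
pose D a := [set z | K z /\ (f z < a%:E)%E].
pose F := filter_from [set a | (l < a%:E)%E] D.
have FF : ProperFilter F.
  apply: filter_from_proper => [|a /= la].
    apply: filter_from_filter => [|a b /= la lb].
      have [a /andP[la _]] := lt_ereal_real lNy.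
      by exists a.
    exists (Num.min a b) => [|z [Kz]]; first by rewrite EFin_min lt_min la lb.
    by rewrite EFin_min lt_min => /andP[].
  have [_ [z Kz <-] za] := ereal_inf_lt la.
  by exists z.
have FK : F K.
  have [a /andP[la _]] := lt_ereal_real lNy.
  by exists a => // z [].
have [x [Kx clx]] := cK F FF FK.
exists x => // z Kz; apply: le_trans (lf _ Kz).
rewrite leNgt; apply/negP => /lt_ereal_real[a /andP[la /lscf[V xV Va]]].
have FD : F (D a) by exists a.
have [y [[_ ya] /Va]] := clx _ _ FD xV.
by rewrite ltNge (ltW ya).
Qed.

Lemma lsc_addl (R : realType) (T : topologicalType) (g : T -> R)
    (f : T -> \bar R) :
  continuous g -> lower_semicontinuous f ->
  lower_semicontinuous (fun x => (g x)%:E + f x)%E.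
Proof.
move=> cg lf x a h.
have : ((a - g x)%:E < f x)%E by rewrite EFinB lteBlDr // addeC.
move=> /lt_ereal_real[c /andP[ac /lf[V xV Vc]]].
exists (V `&` [set z | a - c < g z]).
  apply: filterI => //; apply: (cvgr_gt _ (cg x)).
  by move: ac; rewrite lte_fin; lra.
move=> y [/Vc cy /= gy]; have : ((a - g y)%:E < f y)%E.
  by apply: lt_trans cy; rewrite lte_fin; lra.
by rewrite EFinB lteBlDr // addeC.
Qed.

Lemma continuous_lsc (R : realType) (T : topologicalType) (g : T -> R) :
  continuous g -> lower_semicontinuous (fun x => (g x)%:E).
Proof.
move=> cg x a; rewrite lte_fin => h; exists [set z | a < g z] => //.
exact: (cvgr_gt _ (cg x)).
Qed.

(** * Symmetric matrices and the spectral norm *)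

Section Spectral.
Context {R : realType} {d : nat}.
Implicit Types (A H S M : 'M[R]_d) (u x y : 'cV[R]_d).

Definition psdmx A := A^T = A /\ forall x, 0 <= dotv x (A *m x).

(** The form is nonnegative along every line through [u] and vanishes at [u], so
    its derivative [2 <z, A u>] vanishes in the direction [z = A u]. *)
Lemma psdmx_ker A u : psdmx A -> dotv u (A *m u) = 0 -> A *m u = 0.
Proof.
move=> [sA pA] uAu; set z := A *m u.
have := pA z; set c := dotv z (A *m z) => c0.
(* Proportional to [u - t z] with [t = |z|^2 / (<z, A z> + 1)], a step short
   enough for the linear term to dominate the quadratic one. *)
have := pA ((c + 1) *: u - dotv z z *: z).
rewrite mulmxBr -!scalemxAr !dotv_lin uAu -/z -/c.
rewrite (_ : dotv u (A *m z) = dotv z z); last by rewrite dotv_mulmxr sA.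
move=> h; apply/eqP; rewrite -/z -dotv_eq0; move: h (dotv_ge0 z).
move: (dotv z z) => a h a0.
have : a ^+ 2 * (c + 2) <= 0 by lra.
rewrite pmulr_lle0; last by lra.
by move=> a2; rewrite -sqrf_eq0 eq_le a2 sqr_ge0.
Qed.

(** At a maximizer [u] of the Rayleigh quotient, with value [l], the matrix
    [l - A] is positive semidefinite and its form vanishes at [u], so [u] lies in
    its kernel. The vector [x] excludes dimension zero. *)
Lemma rayleigh A x : A^T = A -> x != 0 ->
  exists u l, [/\ dotv u u = 1, A *m u = l *: u &
    forall y, dotv y (A *m y) <= l * dotv y y].
Proof.
move=> sA x0; pose K := [set z : 'cV[R]_d | dotv z z = 1].
have normK z : z != 0 -> K ((Num.sqrt (dotv z z))^-1 *: z).
  rewrite -dotv_gt0 => z0; rewrite /K /= !dotv_lin.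
  have s0 : 0 < Num.sqrt (dotv z z) by rewrite sqrtr_gt0.
  rewrite -{3}(sqr_sqrtr (ltW z0)); field; exact: lt0r_neq0.
have cK : compact K.
  apply: (@dotv_compact _ _ _ 0 1); last by move=> z; rewrite subr0 => ->.
  apply: (@preimage_closed _ _ (fun z : 'cV[R]_d => dotv z z) [set 1]).
    by move=> y _; apply: continuous_dotv => ?; exact: cvg_id.
  exact: closed_eq.
have lsc : lower_semicontinuous (fun z => (- dotv z (A *m z))%:E).
  have cA : continuous (fun z => dotv z (A *m z)).
    by apply: (@continuous_dotv_mulmx _ _ _ _ A id id) => ?; exact: cvg_id.
  by apply: continuous_lsc => z; exact: cvgN (cA z).
have [u Ku umin] := lsc_compact_min lsc cK (ex_intro _ _ (normK _ x0)).
pose l := dotv u (A *m u).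
have ray y : dotv y (A *m y) <= l * dotv y y.
  have [->|y0] := eqVneq y 0; first by rewrite !dotv_lin mulr0.
  have := umin _ (normK _ y0); rewrite lee_fin lerN2 -scalemxAr !dotv_lin -/l.
  have yy : 0 < dotv y y by rewrite dotv_gt0.
  rewrite mulrA -invfM -expr2 sqr_sqrtr ?(ltW yy) // => h.
  by rewrite -ler_pdivrMr // mulrC.
exists u, l; split => //.
have psd : psdmx (l%:M - A).
  split=> [|y]; first by rewrite linearB /= tr_scalar_mx sA.
  by rewrite mulmxBl mul_scalar_mx !dotv_lin subr_ge0.
have /(psdmx_ker psd) : dotv u ((l%:M - A) *m u) = 0.
  by rewrite mulmxBl mul_scalar_mx !dotv_lin Ku mulr1 subrr.
by rewrite mulmxBl mul_scalar_mx => /eqP; rewrite subr_eq0 => /eqP <-.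
Qed.

End Spectral.

Section OperatorBounds.
Context {R : realType} {d : nat}.
Implicit Types (A H S M : 'M[R]_d) (u x y : 'cV[R]_d).

Lemma symmetric_bound A : A^T = A ->
  exists2 C, 0 < C & forall x, dotv x (A *m x) <= C * dotv x x.
Proof.
move=> sA; have [x0|] := pselect (exists x : 'cV[R]_d, x != 0); last first.
  move=> nx; exists 1 => // x; have [->|x0] := eqVneq x 0.
    by rewrite !dotv_lin mulr0.
  by case: nx; exists x.
have [x /(rayleigh sA)[u [l [_ _ hl]]]] := x0.
exists (`|l| + 1) => [|y]; first by rewrite ltr_pwDr.
by apply: le_trans (hl y) _; rewrite ler_wpM2r ?dotv_ge0 // ler_wpDr // ler_norm.
Qed.

Lemma mulmx_bound e (M : 'M[R]_(e, d)) :
  exists2 C, 0 < C & forall x, dotv (M *m x) (M *m x) <= C * dotv x x.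
Proof.
have [|C C0 hC] := @symmetric_bound (M^T *m M); first by rewrite trmx_mul trmxK.
by exists C => // x; rewrite dotv_mulmxl mulmxA.
Qed.

Lemma spectral_norm_ge0 M : 0 <= spectral_norm M.
Proof.
rewrite /spectral_norm.
have [[[x Sx] ub]|ns] := pselect (has_sup (singular_values M)).
  by apply: le_trans (ub_le_sup ub Sx); case: Sx => l _ <-; exact: sqrtr_ge0.
by rewrite sup_out.
Qed.

(** The top Rayleigh quotient of [M^T *m M] is an eigenvalue, hence its square
    root is one of the singular values below the supremum. *)
Lemma spectral_norm_bound M x :
  dotv (M *m x) (M *m x) <= spectral_norm M ^+ 2 * dotv x x.
Proof.
have [->|x0] := eqVneq x 0; first by rewrite mulmx0 !dotv_lin mulr0.
have sMM : (M^T *m M)^T = M^T *m M by rewrite trmx_mul trmxK.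
have [u [l [u1 Mu ray]]] := rayleigh sMM x0.
have sing_le e : eigenvalue (M^T *m M) e -> e <= l.
  move=> /eigenvalueP[v vM v0].
  have vM' : M^T *m M *m v^T = e *: v^T.
    by rewrite -[M^T *m M]sMM -trmx_mul vM linearZ.
  have vv : 0 < dotv v^T v^T by rewrite dotv_gt0 -trmx0 (inj_eq trmx_inj).
  have := ray v^T; rewrite vM' dotvZr ler_pM2r //.
have l_eig : eigenvalue (M^T *m M) l.
  apply/eigenvalueP; exists u^T.
    by rewrite -{1}sMM -trmx_mul Mu linearZ.
  by rewrite -trmx0 (inj_eq trmx_inj) -dotv_gt0 u1.
have l0 : 0 <= l.
  have := dotv_ge0 (M *m u); rewrite dotv_mulmxl mulmxA Mu dotvZr u1 mulr1 //.
have l_le : Num.sqrt l <= spectral_norm M.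
  apply: ub_le_sup; last by exists l.
  by exists (Num.sqrt l) => _ [e he <-]; rewrite ler_wsqrtr // sing_le.
rewrite dotv_mulmxl mulmxA; apply: le_trans (ray x) _.
rewrite ler_wpM2r ?dotv_ge0 // -[leLHS](sqr_sqrtr l0).
by rewrite ler_pXn2r // nnegrE ?sqrtr_ge0 // spectral_norm_ge0.
Qed.

End OperatorBounds.

Section SquareRoot.
Context {R : realType} {d : nat}.
Implicit Types (A H S M : 'M[R]_d) (u x y : 'cV[R]_d).

(** Deflation: splitting off the top eigenpair lowers the rank by one and keeps
    the matrix positive semidefinite, and the root of the remainder vanishes on
    the removed eigenvector, so the two roots add up. *)
Lemma psdmx_sqrt A : psdmx A -> exists2 S, psdmx S & S *m S = A.
Proof.
have [r] := ubnP (\rank A); elim: r A => // r IH A rA pA.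
have [->|A0] := eqVneq A 0.
  exists 0; last by rewrite mul0mx.
  by split=> [|x]; rewrite ?trmx0 // mul0mx !dotv_lin.
have [sA qA] := pA.
have /existsP[i ci] : [exists i, col i A != 0].
  rewrite -negb_forall; apply: contra A0 => /forallP c0; apply/eqP/matrixP=> i j.
  by have /eqP/matrixP/(_ i 0) := c0 j; rewrite !mxE.
have x0 : delta_mx i 0 != 0 :> 'cV[R]_d.
  by apply: contraNneq ci => x0; rewrite colE x0 mulmx0.
have [u [l [u1 Au ray]]] := rayleigh sA x0.
have l0 : 0 < l.
  rewrite lt_def; apply/andP; split; last first.
    by have := qA u; rewrite Au dotvZr u1 mulr1.
  apply: contraNneq ci => le0; rewrite colE; apply/eqP/psdmx_ker => //.
  by apply/eqP; rewrite eq_le qA andbT (le_trans (ray _)) // le0 mul0r.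
pose P := u *m u^T.
have sP : P^T = P by rewrite /P trmx_mul trmxK.
have Px x : P *m x = dotv u x *: u.
  by rewrite /P -mulmxA [u^T *m x]mx11_scalar mul_mx_scalar.
pose B := A - l *: P.
have Bu : B *m u = 0.
  by rewrite /B mulmxBl Au -scalemxAl Px u1 scale1r subrr.
have pB : psdmx B.
  split=> [|x]; first by rewrite /B linearB linearZ /= sA sP.
  pose y := x - dotv u x *: u.
  have -> : B *m x = B *m y by rewrite /y mulmxBr -scalemxAr Bu scaler0 subr0.
  have uy : dotv u y = 0 by rewrite /y !dotv_lin u1 mulr1 subrr.
  have By : B *m y = A *m y by rewrite /B mulmxBl -scalemxAl Px uy scale0r scaler0 subr0.
  have -> : dotv x (B *m y) = dotv y (B *m y).
    rewrite {3}/y !dotv_lin (_ : dotv u (B *m y) = 0) ?mulr0 ?subr0 //.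
    by rewrite By dotv_mulmxr sA Au dotvZl uy mulr0.
  by rewrite By.
have rB : (\rank B < \rank A)%N.
  have sub : (B <= A)%MS.
    have uA : u^T = l^-1 *: (u^T *m A).
      by rewrite -{1}sA -trmx_mul Au linearZ /= scalerA mulVf ?scale1r ?lt0r_neq0.
    rewrite /B /P addmx_sub // eqmx_opp scalemx_sub //.
    by rewrite uA -scalemxAr scalemx_sub // mulmxA submxMl.
  rewrite ltn_neqAle mxrankS // andbT; apply/negP => /eqP rk.
  have : (A <= B)%MS by rewrite -(mxrank_leqif_sup sub) rk.
  move=> /submxP[D AD]; have := Au; rewrite AD -mulmxA Bu mulmx0 => /esym/eqP.
  rewrite scaler_eq0 (negPf (lt0r_neq0 l0)) /= => /eqP u00.
  by move: u1; rewrite u00 !dotv_lin => /esym/eqP; rewrite oner_eq0.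
have [|S pS SS] := IH B _ pB; first exact: leq_trans rB rA.
have [sS qS] := pS.
have Su : S *m u = 0.
  by apply/eqP; rewrite -dotv_eq0 dotv_mulmxl sS mulmxA SS Bu dotv0r.
have uS : u^T *m S = 0 by rewrite -sS -trmx_mul Su trmx0.
exists (S + Num.sqrt l *: P).
  split=> [|x]; first by rewrite linearD linearZ /= sS sP.
  rewrite mulmxDl -scalemxAl Px !dotv_lin addr_ge0 // mulr_ge0 ?sqrtr_ge0 //.
  by rewrite (dotvC x) -expr2 sqr_ge0.
rewrite mulmxDl !mulmxDr SS -!scalemxAl -!scalemxAr.
have -> : S *m P = 0 by rewrite /P mulmxA Su mul0mx.
have -> : P *m S = 0 by rewrite /P -mulmxA uS mulmx0.
have -> : P *m P = P.
  by rewrite {2}/P mulmxA Px u1 scale1r.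
by rewrite !scaler0 addr0 add0r scalerA -expr2 sqr_sqrtr ?(ltW l0) // /B subrK.
Qed.

Lemma posdefmx_psdmx H : posdefmx H -> psdmx H.
Proof.
move=> [sH pH]; split=> // x; have [->|/pH/ltW //] := eqVneq x 0.
by rewrite mulmx0 !dotv_lin.
Qed.

Lemma posdefmx_unit H : posdefmx H -> H \in unitmx.
Proof.
move=> [sH pH]; rewrite -row_free_unit -kermx_eq0; apply/rowV0P => v.
move=> /sub_kermxP vH; apply/eqP/negPn/negP => v0.
have : v^T != 0 by rewrite -trmx0 (inj_eq trmx_inj).
by move=> /pH; rewrite -sH -trmx_mul vH trmx0 dotv0r ltxx.
Qed.

Lemma sqrtmxP H : posdefmx H ->
  posdefmx (sqrtmx H) /\ sqrtmx H *m sqrtmx H = H.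
Proof.
move=> pH; have [S pS SS] := psdmx_sqrt (posdefmx_psdmx pH).
suff : [set S : 'M[R]_d | posdefmx S /\ S *m S = H] (sqrtmx H) by [].
apply: (@xgetPex _ 0); exists S; split => //; split=> [|x x0]; first by case: pS.
rewrite lt_def; apply/andP; split; last by case: pS.
apply/eqP => /(psdmx_ker pS) Sx; have := pH.2 _ x0.
by rewrite -SS -mulmxA Sx mulmx0 dotv0r ltxx.
Qed.

(** In the norm of [H], the matrix [H^-1 *m M] has operator norm
    [spectral_norm (H^(-1/2) *m M *m H^(-1/2))]; Young's inequality turns the
    bound on the bilinear form into the symmetric form used below. *)
Lemma spectral_bilinear_bound H M (q : R) : posdefmx H -> 0 < q ->
  spectral_norm (invsqrtmx H *m M *m invsqrtmx H) <= q ->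
  forall x y, 2 * dotv (M *m x) y <= q * (dotv x (H *m x) + dotv y (H *m y)).
Proof.
move=> pH q0 Nq x y; have [pS SS] := sqrtmxP pH.
have SU := posdefmx_unit pS; have [sS _] := pS.
move: pS SS SU sS Nq; rewrite /invsqrtmx; set S := sqrtmx H => pS SS SU sS.
set N := invmx S *m M *m invmx S => Nq.
have HS z : dotv z (H *m z) = dotv (S *m z) (S *m z).
  by rewrite dotv_mulmxl sS mulmxA SS.
have MN : M = S *m N *m S by rewrite /N !mulmxA mulmxV // mul1mx mulmxKV.
rewrite !HS MN -(mulmxA (S *m N)) -(mulmxA S N) dotv_mulmxl sS.
move: (S *m x) (S *m y) => {HS}x {}y {MN}.
have h1 : dotv (N *m x) (N *m x) <= q ^+ 2 * dotv x x.
  apply: le_trans (spectral_norm_bound _ _) _.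
  rewrite ler_wpM2r ?dotv_ge0 // ler_pXn2r // nnegrE ?spectral_norm_ge0 //.
  exact: ltW.
have := dotv_ge0 (N *m x - q *: y); rewrite !dotv_lin (dotvC y (N *m x)) => h2.
rewrite -(ler_pM2l q0); nra.
Qed.

End SquareRoot.

(** * Subgradients and proximity operators *)

Definition subgradient (R : realType) (d : nat) (f : 'cV[R]_d -> \bar R)
    (x g : 'cV[R]_d) : Prop :=
  forall u, (f x + (dotv g (u - x))%:E <= f u)%E.

Section Subgradient.
Context {R : realType} {d : nat}.
Implicit Types (f : 'cV[R]_d -> \bar R) (x y u p g h : 'cV[R]_d).

Lemma cauchy_schwarz_norm x y : `|dotv x y| <= norm2 x * norm2 y.
Proof.
rewrite -(@ler_pXn2r _ 2) ?nnegrE ?mulr_ge0 ?sqrtr_ge0 //.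
by rewrite exprMn !norm2_sqr real_normK ?num_real // cauchy_schwarz.
Qed.

Lemma subgradient_fin f x g : Defs.proper f -> subgradient f x g ->
  exists r, f x = r%:E.
Proof.
move=> [fNy [u0 fu0]] sg; case E : (f x) => [r| |]; first by exists r.
  by have := sg u0; rewrite E addye // leye_eq => /eqP fy; move: fu0; rewrite /effdom /= fy.
by have := fNy x; rewrite E.
Qed.

Lemma subgradient_monotone f x y g h : Defs.proper f ->
  subgradient f x g -> subgradient f y h -> 0 <= dotv (g - h) (x - y).
Proof.
move=> pf sx sy; have [a fx] := subgradient_fin pf sx.
have [b fy] := subgradient_fin pf sy.
have := sx y; have := sy x; rewrite fx fy -!EFinD !lee_fin.
rewrite -(opprB x y) !dotv_lin; lra.
Qed.

(** Lower semicontinuity controls [f y] from below and continuity of the inner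
    product controls the affine part, so a strict violation of the subgradient
    inequality at [u] would persist for nearby pairs. The constant [C] bounds the
    fixed vectors that the perturbations are paired with. *)
Lemma subgradient_closed f x g : Defs.proper f -> lower_semicontinuous f ->
  (forall e, 0 < e -> exists y h, [/\ subgradient f y h,
     dotv (y - x) (y - x) < e & dotv (h - g) (h - g) < e]) ->
  subgradient f x g.
Proof.
move=> pf lf near u; case E : (f u) => [r| |]; [|by rewrite leey|by case: pf => /(_ u); rewrite E].
rewrite leNgt; apply/negP; rewrite -lteBlDr // -EFinB.
move=> /lt_ereal_real[a /andP[]]; rewrite lte_fin => ra /lf[V /nbhs_dotv[e e0 eV] Va].
pose eta := a - (r - dotv g (u - x)); have eta0 : 0 < eta by rewrite subr_gt0.
pose C := 1 + dotv (u - x) (u - x) + dotv g g.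
have [ux0 gg0] := (dotv_ge0 (u - x), dotv_ge0 g).
have C0 : 0 < C by rewrite /C; lra.
pose k := eta / 4; have k0 : 0 < k by rewrite divr_gt0.
have [|y [h [sg yx hg]]] := near (Num.min e (Num.min k (k ^+ 2 / C))).
  by rewrite !lt_min e0 k0 divr_gt0 // exprn_gt0.
move: yx hg; rewrite !lt_min => /and3P[ye yk yC] /and3P[_ hk hC].
have fy := Va _ (eV _ ye).
have := sg u; have [c fc] := subgradient_fin pf sg.
move: fy; rewrite fc E -EFinD lee_fin lte_fin => ac cr.
have small z w : dotv z z < k ^+ 2 / C -> dotv w w <= C -> - k <= dotv z w.
  rewrite ltr_pdivlMr // => zC wC.
  have := cauchy_schwarz z w => CS.
  have : dotv z w ^+ 2 <= k ^+ 2.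
    apply: le_trans CS _; apply: le_trans (ltW zC).
    by rewrite ler_wpM2l ?dotv_ge0.
  by move=> zw; nra.
have h1 : - k <= dotv (h - g) (u - x) by apply: small => //; rewrite /C; lra.
have h2 : - k <= dotv (x - y) g.
  by apply: small; [rewrite -(opprB y x) dotvNl dotvNr opprK|rewrite /C; lra].
have h3 : - k <= dotv (h - g) (x - y).
  have := dotv_ge0 (h - g + (x - y)); move: yk; rewrite -(opprB x y) dotvNl dotvNr opprK.
  rewrite (dotvDl _ (x - y)) !(dotvDr _ _ (x - y)) (dotvC (x - y) (h - g)); lra.
have : dotv h (u - y) =
    dotv g (u - x) + dotv (h - g) (u - x) + dotv (x - y) g + dotv (h - g) (x - y).
  rewrite (dotvC (x - y) g) !dotv_lin; ring.
rewrite /k /eta in k0 h1 h2 h3 *; lra.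
Qed.

End Subgradient.

Section Prox.
Context {R : realType} {d : nat}.
Implicit Types (f : 'cV[R]_d -> \bar R) (x y u p g h : 'cV[R]_d) (tau : R).

(** First-order optimality; for the direct implication the objective is
    compared along the segment from [p] to [u], whose quadratic term is
    negligible near [p]. *)
Lemma prox_argmin_subgradient f tau x p : Defs.proper f -> econvex f -> 0 < tau ->
  prox_argmin (fun u => (tau%:E * f u)%E) x p <->
  subgradient f p (tau^-1 *: (x - p)).
Proof.
move=> pf cf t0; have ti : 0 < tau^-1 by rewrite invr_gt0.
have expand u : dotv (u - x) (u - x) =
    dotv (p - x) (p - x) + 2 * dotv (u - p) (p - x) + dotv (u - p) (u - p).
  have -> : u - x = (p - x) + (u - p) by rewrite [RHS]addrC subrKA.
  by rewrite dotvDl !(dotvDr _ (p - x) (u - p)) (dotvC (p - x) (u - p)); ring.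
have fNy u : f u != -oo%E by case: pf.
have xp u : dotv (x - p) (u - p) = - dotv (u - p) (p - x).
  by rewrite dotvC -(opprB p x) dotvNr.
split=> [pm u|sg u]; last first.
  have [a fp] := subgradient_fin pf sg.
  have := sg u; have := fNy u; rewrite !norm2_sqr.
  case: (f u) => [r| |] // _; rewrite fp; last by rewrite gt0_muley // addey ?leey.
  rewrite -!EFinM -!EFinD !lee_fin dotvZl xp (expand u) => h.
  have := dotv_ge0 (u - p); have := ler_wpM2l (ltW t0) h.
  rewrite mulrDr mulrA mulfV ?lt0r_neq0 // mul1r; lra.
have [a fp] : exists a, f p = a%:E.
  case: pf => _ [u0 fu0]; move: fu0 (fNy p) (fNy u0) (pm u0); rewrite /effdom /=.
  case: (f u0) => [r| |] // _; case: (f p) => [a| |] // _ _; first by exists a.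
  by rewrite gt0_muley // addey // -EFinM -EFinD leye_eq.
case E : (f u) => [r| |]; [|by rewrite leey|by have := fNy u; rewrite E].
rewrite fp -EFinD lee_fin dotvZl xp -(ler_pM2l t0) mulrDr mulrA mulfV ?lt0r_neq0 //.
rewrite mul1r.
pose Q := dotv (u - p) (p - x) + tau * (r - a); pose B := dotv (u - p) (u - p).
have B0 : 0 <= B by exact: dotv_ge0.
suff : 0 <= Q by rewrite /Q; lra.
have step t : 0 < t < 1 -> 0 <= Q + t * (B / 2).
  move=> /andP[tp t1]; have := cf u p t; rewrite tp t1 => /(_ isT).
  have := pm (t *: u + (1 - t) *: p); rewrite E fp -!EFinM -EFinD !norm2_sqr.
  rewrite expand; have -> : t *: u + (1 - t) *: p - p = t *: (u - p).
    by apply/colP => i; rewrite !mxE; ring.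
  case: (f (t *: u + (1 - t) *: p)) (fNy (t *: u + (1 - t) *: p)) => [c| |] // _.
  rewrite -EFinM -!EFinD !lee_fin !dotvZl !dotvZr -/B => h1 h2.
  rewrite -(pmulr_rge0 _ tp) /Q.
  have := ler_wpM2l (ltW t0) h2; nra.
rewrite leNgt; apply/negP => Q0.
have den : 0 < B + 1 - Q by lra.
(* If [Q < 0], this step lies in (0, 1) and makes [Q + t B / 2] negative. *)
have := step (- Q / (B + 1 - Q)).
rewrite divr_gt0 ?oppr_gt0 // ltr_pdivrMr // mul1r.
have -> : - Q < B + 1 - Q by lra.
move=> /(_ isT) h; have := mulr_ge0 (ltW den) h.
have -> : (B + 1 - Q) * (Q + - Q / (B + 1 - Q) * (B / 2)) =
  Q * (B / 2 + 1 - Q) by field; exact: lt0r_neq0.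
nra.
Qed.

(** Convexity propagates a lower bound of [f] on a unit ball around a point of
    its domain to a linear lower bound on all of space, so the prox objective
    is coercive and attains its minimum over a large ball. *)
Lemma prox_argmin_nonempty f tau x : Gamma0 f -> 0 < tau ->
  prox_argmin (fun u => (tau%:E * f u)%E) x !=set0.
Proof.
move=> [[fNy [x0 fx0]] lf cf] t0.
have [f0 Ef0] : exists r, f x0 = r%:E.
  by move: fx0 (fNy x0); rewrite /effdom /=; case: (f x0) => [r| |] // _ _; exists r.
have ball0 r : 0 <= r -> [set z | dotv (z - x0) (z - x0) <= r ^+ 2] !=set0.
  by move=> _; exists x0; rewrite /= subrr dotv_lin sqr_ge0.
have [um Bum umin] := lsc_compact_min lf (@ball_dotv_compact _ _ x0 (1 ^+ 2)) (ball0 _ ler01).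
have [c Ec] : exists r, f um = r%:E.
  have := umin x0; rewrite Ef0 /= subrr dotv_lin expr1n => /(_ ler01).
  by move: (fNy um); case: (f um) => [r| |] // _ _; exists r.
have cf0 : c <= f0.
  by have := umin x0; rewrite Ef0 Ec /= subrr dotv_lin expr1n lee_fin => /(_ ler01).
have minor u r : f u = r%:E -> 1 < norm2 (u - x0) ->
    f0 - (f0 - c) * norm2 (u - x0) <= r.
  move=> Eu n1; set n := norm2 _ in n1 *.
  have n0 : 0 < n by lra.
  have ni : 0 < n^-1 < 1 by rewrite invr_gt0 n0 invf_lt1.
  have := cf u x0 n^-1 ni; have /= := umin (n^-1 *: u + (1 - n^-1) *: x0).
  have -> : n^-1 *: u + (1 - n^-1) *: x0 - x0 = n^-1 *: (u - x0).
    by apply/colP => i; rewrite !mxE; ring.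
  rewrite dotvZl dotvZr -norm2_sqr -/n expr1n.
  have -> : n^-1 * (n^-1 * n ^+ 2) = 1 by field; exact: lt0r_neq0.
  move=> /(_ (lexx _)) h1 h2; have := le_trans h1 h2.
  rewrite Ec Eu Ef0 -!EFinM -EFinD lee_fin => h.
  have := ler_wpM2l (ltW n0) h.
  have -> : n * (n^-1 * r + (1 - n^-1) * f0) = r + n * f0 - f0.
    by field; exact: lt0r_neq0.
  lra.
(* Beyond this radius the quadratic term outgrows both the linear minorant and
   the cross term, so the objective exceeds its value at [x0]. *)
pose rho := 2 * (tau * (f0 - c) + norm2 (x0 - x)) + 1.
have nx0 : 0 <= norm2 (x0 - x) by exact: sqrtr_ge0.
have tf0 : 0 <= tau * (f0 - c) by rewrite mulr_ge0 ?subr_ge0 // ltW.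
have rho1 : 1 <= rho by rewrite /rho; lra.
pose obj u := ((2^-1 * norm2 (u - x) ^+ 2)%:E + tau%:E * f u)%E.
have lobj : lower_semicontinuous obj.
  apply: (@lsc_addl R _ (fun u => 2^-1 * norm2 (u - x) ^+ 2)).
    rewrite [X in continuous X](_ : _ = fun u => dotv (u - x) ((2^-1)%:M *m (u - x))).
      by apply: continuous_dotv_mulmx; exact: continuous_translate.
    by apply/funext => u; rewrite norm2_sqr mul_scalar_mx dotvZr.
  move=> u a; rewrite -lte_pdivrMl // -EFinM => /lf[V uV Va]; exists V => // y /Va.
  by rewrite EFinM lte_pdivrMl.
have [p Bp pmin] := lsc_compact_min lobj (@ball_dotv_compact _ _ x0 (rho ^+ 2))
  (ball0 _ (le_trans ler01 rho1)).
exists p => u; have [Bu|Bu] := leP (dotv (u - x0) (u - x0)) (rho ^+ 2).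
  exact: pmin.
apply: le_trans (pmin x0 _) _; first by rewrite /= subrr dotv_lin sqr_ge0.
rewrite /obj Ef0; case E : (f u) (fNy u) => [r| |] // _; last first.
  by rewrite gt0_muley // addey // leey.
have rn : rho < norm2 (u - x0).
  rewrite -(@ltr_pXn2r _ 2) ?nnegrE ?sqrtr_ge0 ?norm2_sqr //.
  exact: le_trans ler01 rho1.
have := minor _ _ E (le_lt_trans rho1 rn) => /(ler_wpM2l (ltW t0)) h.
rewrite -!EFinM -!EFinD lee_fin.
have := cauchy_schwarz_norm (u - x0) (x0 - x); rewrite ler_norml => /andP[CS _].
have -> : norm2 (u - x) ^+ 2 =
    norm2 (u - x0) ^+ 2 + 2 * dotv (u - x0) (x0 - x) + norm2 (x0 - x) ^+ 2.
  rewrite !norm2_sqr (_ : u - x = (u - x0) + (x0 - x)); last by rewrite subrKA.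
  rewrite dotvDl !(dotvDr _ (u - x0) (x0 - x)) (dotvC (x0 - x) (u - x0)); ring.
move: rn CS h nx0; rewrite /rho.
move: (norm2 (u - x0)) (norm2 (x0 - x)) (dotv _ _) => n k w rn CS h nx0.
rewrite mulrBr mulrA in h.
have n0 : 0 < n by lra.
have : 0 <= n * (n / 2 - tau * (f0 - c) - k) by rewrite mulr_ge0 //; lra.
nra.
Qed.

(** Existence of the minimizer turns the value of [prox] into an element of the
    argmin, and monotonicity of subgradients makes that element unique. *)
Lemma prox_fixed f tau p h : Gamma0 f -> 0 < tau ->
  prox (fun u => (tau%:E * f u)%E) (p + tau *: h) = p <-> subgradient f p h.
Proof.
move=> Gf t0; have [pf _ cf] := Gf.
have eh q : tau^-1 *: (q + tau *: h - q) = h.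
  by rewrite addrAC subrr add0r scalerA mulVf ?lt0r_neq0 // scale1r.
have := prox_argmin_nonempty (p + tau *: h) Gf t0 => /(xgetPex 0).
rewrite -/(prox _ _) => am; split=> [pe|sg].
  by move: am; rewrite pe => /(prox_argmin_subgradient _ _ pf cf t0); rewrite eh.
move: am => /(prox_argmin_subgradient _ _ pf cf t0).
set q := prox _ _ => sq.
have := subgradient_monotone pf sg sq.
have -> : h - tau^-1 *: (p + tau *: h - q) = - (tau^-1 *: (p - q)).
  by rewrite addrAC scalerDr scalerA mulVf ?lt0r_neq0 // scale1r opprD addrCA subrr addr0.
rewrite !dotvNl dotvZl oppr_ge0 pmulr_rle0 ?invr_gt0 // => pq.
apply/esym/eqP; rewrite -subr_eq0 -dotv_eq0.
by rewrite eq_le pq dotv_ge0.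
Qed.

(** Only the point [b] contributes to the supremum, so the conjugate is linear and
    its proximity operator is a translation. *)
Lemma fconj_indicator (b y : 'cV[R]_d) :
  fconj (indicator [set b]) y = (dotv b y)%:E.
Proof.
rewrite /fconj; apply/eqP; rewrite eq_le; apply/andP; split.
  apply: ge_ereal_sup => _ [x _ <-]; rewrite /indicator.
  case: ifP => [|_]; last by rewrite addeNy leNye.
  by rewrite inE /= => ->; rewrite sube0.
apply: ereal_sup_ubound; exists b => //.
by rewrite /indicator ifT ?sube0 // inE.
Qed.

Lemma Gamma0_linear (b : 'cV[R]_d) : Gamma0 (fun y => (dotv b y)%:E).
Proof.
split.
- by split=> //; exists 0; rewrite /effdom /= ltry.
- apply: continuous_lsc; apply: (@continuous_dotv _ _ _ (fun=> b) id).
    exact: cst_continuous.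
  by move=> ?; exact: cvg_id.
- by move=> x y t _; rewrite -!EFinM -EFinD lee_fin !dotv_lin.
Qed.

Lemma subgradient_linear (b y h : 'cV[R]_d) :
  subgradient (fun y => (dotv b y)%:E) y h <-> h = b.
Proof.
split=> [sg|-> u]; last by rewrite -EFinD lee_fin !dotv_lin addrC subrK.
have := sg (y + (h - b)); rewrite -EFinD lee_fin addrAC subrr add0r.
rewrite (dotvDr b) lerD2l -subr_ge0 -dotvNl -dotvDl -opprB dotvNl oppr_ge0 => le0.
apply/eqP; rewrite -subr_eq0 -dotv_eq0.
by rewrite eq_le le0 dotv_ge0.
Qed.

Lemma prox_conj_indicator_fixed (b y h : 'cV[R]_d) beta : 0 < beta ->
  prox (fun u => (beta%:E * fconj (indicator [set b]) u)%E) (y + beta *: h) = y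
  <-> h = b.
Proof.
move=> b0; rewrite -(subgradient_linear b y h) -(prox_fixed y h (Gamma0_linear b) b0).
by under eq_fun do rewrite fconj_indicator.
Qed.

End Prox.

(** * Lagrange multipliers *)

(** An algebraic Hahn-Banach theorem, one coordinate at a time: the slope along
    the first coordinate is the infimum of the slopes allowed by the points of
    the cone on the positive half of that axis. *)
Lemma cone_linear_minorant (R : realType) m (K : 'cV[R]_m -> R -> Prop) :
  (forall w r w' r', K w r -> K w' r' -> K (w + w') (r + r')) ->
  (forall t w r, 0 < t -> K w r -> K (t *: w) (t * r)) ->
  (forall w r, K w r -> exists r', K (- w) r') ->
  (forall r, K 0 r -> 0 <= r) ->
  exists y, forall w r, K w r -> dotv y w <= r.
Proof.
elim: m K => [|m IH] K KD KZ KN K0.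
  by exists 0 => w r; rewrite dotv0l (flatmx0 w); exact: K0.
pose mk (a : R) (w : 'cV[R]_m) : 'cV[R]_m.+1 := col_mx (a%:M : 'cV_1) w.
have mkD a w a' w' : mk a w + mk a' w' = mk (a + a') (w + w').
  by apply: etrans (@add_col_mx _ 1 m 1 _ _ _ _) _; rewrite -raddfD.
have mkZ t a w : t *: mk a w = mk (t * a) (t *: w).
  by apply: etrans (@scale_col_mx _ 1 m 1 _ _ _) _; rewrite scale_scalar_mx.
have mkN a w : - mk a w = mk (- a) (- w).
  by rewrite -scaleN1r mkZ mulN1r scaleN1r.
have mk0 : mk 0 0 = 0 by have := mkZ 0 0 0; rewrite scale0r mul0r scaler0 => <-.
have mkE (w : 'cV[R]_m.+1) : exists a w', w = mk a w'.
  exists (usubmx (w : 'cV_(1 + m)) 0 0), (dsubmx (w : 'cV_(1 + m))).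
  by rewrite /mk -mx11_scalar vsubmxK.
(* The bounds on the slope coming from the two half-axes are compatible, because
   a positive combination of the two points lies above [0]. *)
have opp a r a' r' : 0 < a -> a' < 0 -> K (mk a 0) r -> K (mk a' 0) r' ->
    r' / a' <= r / a.
  move=> a0 a'0 Kr Kr'; have na' : 0 < - a' by rewrite oppr_gt0.
  have := KD _ _ _ _ (KZ _ _ _ na' Kr) (KZ _ _ _ a0 Kr').
  rewrite !mkZ mkD !scaler0 addr0 mulNr (mulrC a') addNr mk0 => /K0 h.
  rewrite -[r' / a']mulrNN -invrN ler_pdivrMr // mulrAC ler_pdivlMr //; lra.
pose Q := [set x | exists a r, [/\ 0 < a, K (mk a 0) r & x = r / a]].
have [c cP] : exists c, forall a r, K (mk a 0) r -> c * a <= r.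
  have [[q Qq]|nQ] := pselect (Q !=set0).
    exists (inf Q) => a r Kr.
    have [a0|a0|a0] := ltrgt0P a.
    - rewrite -ler_pdivlMr //; apply: ge_inf; last by exists a, r.
      have [r' Kr'] := KN _ _ Kr; rewrite mkN oppr0 in Kr'.
      exists (r' / - a) => _ [a1 [r1 [a10 K1 ->]]].
      by apply: opp => //; rewrite oppr_lt0.
    - rewrite -ler_ndivrMr //; apply: lb_le_inf; first by exists q.
      by move=> _ [a1 [r1 [a10 K1 ->]]]; apply: opp.
    - by move: Kr; rewrite a0 mulr0 mk0 => /K0.
  have npos a r : K (mk a 0) r -> a <= 0.
    by rewrite leNgt => Kr; apply/negP => a0; apply: nQ; exists (r / a), a, r.
  exists 0 => a r Kr; rewrite mul0r; apply: K0; rewrite -mk0.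
  have [r' Kr'] := KN _ _ Kr; rewrite mkN oppr0 in Kr'.
  by have := npos _ _ Kr; have := npos _ _ Kr'; rewrite oppr_le0 => h1 h2;
    rewrite (_ : 0 = a) //; apply/eqP; rewrite eq_le h1 h2.
pose K' w s := exists a r, K (mk a w) r /\ s = r - c * a.
have [||||y yP] := IH K'.
- move=> w _ w' _ [a [r [Kr ->]]] [a' [r' [Kr' ->]]].
  exists (a + a'), (r + r'); rewrite -mkD; split; [exact: KD|ring].
- move=> t w _ t0 [a [r [Kr ->]]].
  exists (t * a), (t * r); rewrite -mkZ; split; [exact: KZ|ring].
- move=> w _ [a [r [Kr _]]]; have [r' Kr'] := KN _ _ Kr.
  by exists (r' - c * - a), (- a), r'; rewrite -mkN.
- by move=> _ [a [r [Kr ->]]]; rewrite subr_ge0; exact: cP.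
exists (mk c y) => w r; have [a [w' ->]] := mkE w => Kr.
have : K' w' (r - c * a) by exists a, r.
move=> /yP h; rewrite [dotv _ _](@dotv_col_mx R 1 m).
by rewrite {1}/dotv tr_scalar_mx -scalar_mxM mxE /=; lra.
Qed.

(** The prolongation of the segment beyond [x] stays in the affine hull, and near
    [x] the affine hull is contained in the set. *)
Lemma relint_extend (R : realType) d (S : set 'cV[R]_d) x z :
  relint S x -> S z -> exists2 t, 0 < t & S (x + t *: (x - z)).
Proof.
move=> [hx [V Vx VS]] Sz; have [e e0 eV] := nbhs_dotv Vx.
pose D := dotv (x - z) (x - z); have D0 : 0 <= D by exact: dotv_ge0.
pose t := Num.min 1 (e / (D + 1)).
have De : 0 < e / (D + 1) by rewrite divr_gt0 //; lra.
have t0 : 0 < t by rewrite /t lt_min ltr01.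
have te : t * (D + 1) <= e.
  by rewrite -ler_pdivlMr /t ?ge_min ?lexx ?orbT //; lra.
have t1 : t <= 1 by rewrite /t ge_min lexx.
exists t => //; apply: VS; split.
  apply: eV; rewrite addrAC subrr add0r dotvZl dotvZr -/D; nra.
move=> B [affB SB]; have -> : x + t *: (x - z) = (1 + t) *: x + (1 - (1 + t)) *: z.
  by apply/colP => i; rewrite !mxE; ring.
exact: (affB _ _ _ (hx B (conj affB SB)) (SB _ Sz)).
Qed.

(** The perturbations [A z - b] of the constraint, paired
    with the excess of objective value, generate a cone to which the algebraic
    Hahn-Banach theorem applies; the relative interior condition makes its
    projection a linear subspace. *)
Lemma exists_multiplier (R : realType) n m (F : 'cV[R]_n -> \bar R)
    (A : 'M[R]_(m, n)) b x : Defs.proper F -> econvex F ->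
  [set A *m z | z in relint (effdom F)] b ->
  A *m x = b -> (forall z, A *m z = b -> (F x <= F z)%E) ->
  exists y, subgradient F x (A^T *m y).
Proof.
move=> [FNy _] cF [x0 rx0 Ax0] Ax xmin.
have dom z r : F z = r%:E -> effdom F z by rewrite /effdom /= => ->; rewrite ltry.
have fin z : effdom F z -> exists r, F z = r%:E.
  by have := FNy z; rewrite /effdom /=; case: (F z) => [r| |] // _ _; exists r.
have [[r0 Fx0] [p Fx]] : (exists r, F x0 = r%:E) /\ exists p, F x = p%:E.
  have /fin[r0 Fx0] : effdom F x0.
    by case: rx0 => hx [V Vx]; apply; split=> //; exact: nbhs_singleton.
  split; first by exists r0.
  by apply: fin; apply: (le_lt_trans (xmin _ Ax0)); rewrite Fx0 ltry.
pose K w s := exists t z r,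
  [/\ 0 < t, F z = r%:E, w = t *: (A *m z - b) & t * (r - p) <= s].
have [||||y yP] := @cone_linear_minorant R m K.
- move=> _ s _ s' [t [z [r [t0 Fz -> h]]]] [t' [z' [r' [t'0 Fz' -> h']]]].
  have tt : 0 < t + t' by rewrite addr_gt0.
  pose k := t / (t + t').
  have k1 : 1 - k = t' / (t + t') by rewrite /k; field; exact: lt0r_neq0.
  have k01 : 0 < k < 1.
    by rewrite -subr_gt0 k1 !divr_gt0.
  have := cF z z' k k01; rewrite Fz Fz' -!EFinM -EFinD.
  case E : (F _) (FNy (k *: z + (1 - k) *: z')) => [c| |] // _; rewrite lee_fin => hc.
  exists (t + t'), (k *: z + (1 - k) *: z'), c; split=> //.
    rewrite mulmxDr -!scalemxAr k1 /k; apply/colP => i; rewrite !mxE.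
    by field; exact: lt0r_neq0.
  have := ler_wpM2l (ltW tt) hc; rewrite k1 /k.
  have -> : (t + t') * (t / (t + t') * r + t' / (t + t') * r') = t * r + t' * r'.
    by field; exact: lt0r_neq0.
  lra.
- move=> l _ s l0 [t [z [r [t0 Fz -> h]]]].
  exists (l * t), z, r; split; rewrite ?mulr_gt0 ?scalerA //.
  by rewrite -mulrA ler_pM2l.
- move=> _ s [t [z [r [t0 Fz -> h]]]].
  have [l l0 /fin[c Fc]] := relint_extend rx0 (dom _ _ Fz).
  exists (t / l * (c - p)), (t / l), (x0 + l *: (x0 - z)), c.
  split=> //; first by rewrite divr_gt0.
  rewrite mulmxDr -scalemxAr mulmxBr Ax0; apply/colP => i; rewrite !mxE.
  by field; exact: lt0r_neq0.
- move=> s [t [z [r [t0 Fz /esym/eqP w0 h]]]]; apply: le_trans h.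
  rewrite mulr_ge0 ?(ltW t0) // subr_ge0 -lee_fin -Fz -Fx; apply: xmin.
  by move: w0; rewrite scaler_eq0 (negPf (lt0r_neq0 t0)) subr_eq0 => /eqP.
exists y => u; case E : (F u) (FNy u) => [r| |] // _; last by rewrite leey.
rewrite Fx -EFinD lee_fin -dotv_mulmxr mulmxBr Ax.
have /yP : K (A *m u - b) (r - p) by exists 1, u, r; rewrite scale1r mul1r.
lra.
Qed.

Lemma submxcolZ (R : pzRingType) (s : nat) (n_ : 'I_s -> nat) p (a : R)
    (x : 'M[R]_((\sum_(i < s) n_ i)%N, p)) i :
  submxcol (a *: x) i = a *: submxcol x i.
Proof. by apply/matrixP => j k; rewrite !mxE. Qed.

Section SeparableSum.
Context {R : realType} {s : nat} {n_ : 'I_s -> nat}.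
Variable f : forall i : 'I_s, 'cV[R]_(n_ i) -> \bar R.
Arguments f : clear implicits.
Hypothesis f_Gamma0 : forall i, Gamma0 (f i).
Local Notation N := (\sum_(i < s) n_ i)%N.

Lemma sumf_neqNy x : sumf f x != -oo%E.
Proof.
rewrite /sumf esum_eqNy; apply/existsP => -[i /andP[_]].
by have [[fNy _] _ _] := f_Gamma0 i; rewrite (negPf (fNy _)).
Qed.

Lemma sumf_fin x r : sumf f x = r%:E -> forall i, exists a, f i (submxcol x i) = a%:E.
Proof.
move=> xr i; have : sumf f x \is a fin_num by rewrite xr.
move=> /sum_fin_numP/(_ i); rewrite mem_index_enum => /(_ isT isT)/fineK <-.
by exists (fine (f i (submxcol x i))).
Qed.

Lemma sumf_proper : Defs.proper (sumf f).
Proof.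
split; first exact: sumf_neqNy.
have /(_ _)/cid-/all_sig[x0 fx0] : forall i, effdom (f i) !=set0.
  by move=> i; have [[]] := f_Gamma0 i.
exists (\mxcol_i x0 i); rewrite /effdom /= /sumf.
by apply: lte_sum_pinfty => i _; rewrite mxcolK; exact: fx0.
Qed.

Lemma sumf_convex : econvex (sumf f).
Proof.
move=> x y t t01; have fNy i z : f i z != -oo%E by have [[]] := f_Gamma0 i.
have dis (z : 'cV[R]_N) (a : R) :
    (a%:E * sumf f z = \sum_(i < s) a%:E * f i (submxcol z i))%E.
  rewrite /sumf fin_num_sume_distrr // => i j _ _.
  by move: (fNy i (submxcol z i)) (fNy j (submxcol z j)); do 2 case: (f _ _).
rewrite !dis -big_split /=; apply: lee_sum => i _.
rewrite submxcolD !submxcolZ; have [_ _ cf] := f_Gamma0 i; exact: cf.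
Qed.

(** For the direct implication, the test point differs from [x] in block [i] only,
    and the finite values of the other blocks cancel. *)
Lemma subgradient_sumf x g :
  subgradient (sumf f) x g <->
  forall i, subgradient (f i) (submxcol x i) (submxcol g i).
Proof.
split=> [sg i u|sg u]; last first.
  rewrite dotv_mxcol -sumEFin /sumf -big_split /=; apply: lee_sum => i _.
  by rewrite submxcolB; exact: sg.
have [r Fx] := subgradient_fin sumf_proper sg.
pose z := \mxcol_j eqtype.dfwith (fun j => submxcol x j) u j.
have gz : dotv g (z - x) = dotv (submxcol g i) (u - submxcol x i).
  rewrite dotv_mxcol (bigD1 i) //= [X in _ + X = _]big1 ?addr0.
    by rewrite submxcolB mxcolK dfwith_in.
  by move=> j ji; rewrite submxcolB mxcolK dfwith_out ?subrr ?dotv0r // eq_sym.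
have := sg z; rewrite gz /sumf !(bigD1 i (P := predT)) //=.
rewrite mxcolK dfwith_in.
rewrite [X in (_ <= _ + X)%E](eq_bigr (fun j => f j (submxcol x j))); last first.
  by move=> j ji; rewrite mxcolK dfwith_out // eq_sym.
rewrite addeAC leeD2rE //; apply/sum_fin_numP => j _ _.
by have [a ->] := sumf_fin Fx j.
Qed.

End SeparableSum.

(** * Reflected resolvent iterations *)

(** [x] is the image of [H^(1/2) x] under the bounded map [H^(-1/2)], and
    [|H^(1/2) x|^2 = <x, H x>]. *)
Lemma posdefmx_coercive (R : realType) (d : nat) (H : 'M[R]_d) : posdefmx H ->
  exists2 c, 0 < c & forall x, dotv x x <= c * dotv x (H *m x).
Proof.
move=> pH; have [pS SS] := sqrtmxP pH; have [sS _] := pS.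
have [c c0 hc] := mulmx_bound (invmx (sqrtmx H)); exists c => // x.
have := hc (sqrtmx H *m x); rewrite mulKmx ?posdefmx_unit //.
by rewrite (dotv_mulmxl (sqrtmx H)) sS mulmxA SS.
Qed.

(** The losses [D k] are bounded by the distance of [L k] to its infimum. *)
Lemma nonincreasing_gap (R : realType) (L D : nat -> R) :
  (forall k, 0 <= L k) -> (forall k, 0 <= D k) ->
  (forall k, L k.+1 + D k <= L k) ->
  forall e, 0 < e -> exists N, forall k, (N <= k)%N -> D k < e.
Proof.
move=> L0 D0 LD e e0.
have Linc k j : L (k + j)%N <= L k.
  elim: j => [|j IH]; first by rewrite addn0.
  by rewrite addnS; have := LD (k + j)%N; have := D0 (k + j)%N; lra.
have hi : has_inf (range L).
  by split; [exists (L 0%N), 0%N|exists 0 => _ [k _ <-]].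
have [_ [N _ <-] LN] := inf_adherent e0 hi.
exists N => k Nk; have := LD k; have := Linc N (k - N)%N; rewrite subnKC //.
have : inf (range L) <= L k.+1 by apply: ge_inf; [case: hi|exists k.+1].
lra.
Qed.

Section ReflectedIteration.
Context {R : realType} {d : nat} (H M : 'M[R]_d) (q : R).
Context (G : 'cV[R]_d -> 'cV[R]_d -> Prop) (u : nat -> 'cV[R]_d).
Hypothesis pH : posdefmx H.
Hypothesis q01 : 0 < q < 2^-1.
Hypothesis young : forall x y,
  2 * dotv (M *m x) y <= q * (dotv x (H *m x) + dotv y (H *m y)).
Hypothesis Gmono : forall x y g h, G x g -> G y h -> 0 <= dotv (g - h) (x - y).
Hypothesis Gclosed : forall x g,
  (forall e, 0 < e -> exists y h, [/\ G y h,
     dotv (y - x) (y - x) < e & dotv (h - g) (h - g) < e]) -> G x g.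
Hypothesis uG : forall k, G (u k.+2)
  (M *m (u k.+2 - u k.+1) - M *m (u k.+1 - u k) - H *m (u k.+2 - u k.+1)).

Let sqnH x := dotv x (H *m x).
Let step k := u k.+1 - u k.

(** The correction of the squared distance absorbs the reflection term, whose
    inner product with the next error telescopes up to a multiple of the steps. *)
Let lyap w k :=
  sqnH (u k.+1 - w) - 2 * dotv (M *m step k) (u k.+1 - w) + q * sqnH (step k).

Let sqnH_ge0 x : 0 <= sqnH x.
Proof. by case: (posdefmx_psdmx pH) => _; apply. Qed.

(** Monotonicity between [u k.+2] and [w], the identity for the [H]-norm of a sum,
    and [young] applied to two consecutive steps. *)
Let lyap_descent w k : G w 0 ->
  lyap w k.+1 + (1 - 2 * q) * sqnH (step k.+1) <= lyap w k.
Proof.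
move=> Gw; have := Gmono (uG k) Gw; rewrite subr0 /lyap -/(step k) -/(step k.+1).
have -> : u k.+2 - w = (u k.+1 - w) + step k.+1 by rewrite [RHS]addrC subrKA.
move: (u k.+1 - w) (step k) (step k.+1) => e p r.
have := young p (- r); rewrite /sqnH !mulmxDr !mulmxN !dotvNl !dotvNr opprK.
rewrite !dotv_lin (_ : dotv r (H *m e) = dotv (H *m r) e); last first.
  by rewrite dotv_mulmxr; case: pH => ->.
rewrite (dotvC e (H *m r)) (dotvC (H *m r) r); lra.
Qed.

Let lyap_lower w k : (1 - q) * sqnH (u k.+1 - w) <= lyap w k.
Proof. by rewrite /lyap; have := young (step k) (u k.+1 - w); rewrite -/(sqnH _) -/(sqnH _); lra. Qed.

Let lyap_ge0 w k : 0 <= lyap w k.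
Proof.
apply: le_trans (lyap_lower w k); rewrite mulr_ge0 // subr_ge0.
by case/andP: q01; lra.
Qed.

Let lyap_upper w k : lyap w k <= 2 * sqnH (u k.+1 - w) + sqnH (step k).
Proof.
rewrite /lyap; have := young (step k) (- (u k.+1 - w)).
rewrite mulmxN !dotvNr dotvNl opprK -/(sqnH _) -/(sqnH _).
have := sqnH_ge0 (step k); have := sqnH_ge0 (u k.+1 - w); case/andP: q01; nra.
Qed.

Let lyap_nincr w k j : G w 0 -> lyap w (k + j)%N <= lyap w k.
Proof.
move=> Gw; elim: j => [|j IH]; first by rewrite addn0.
rewrite addnS; have := lyap_descent (k + j)%N Gw.
have := sqnH_ge0 (step (k + j).+1); case/andP: q01; nra.
Qed.

(** Bounding the iterates with a first zero [w0] gives a cluster point [w]; since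
    the steps vanish, [w] is itself a zero, and the descent relative to [w]
    upgrades clustering to convergence. *)
Lemma reflected_iteration_converges : (exists w, G w 0) ->
  exists w, G w 0 /\ forall e, 0 < e ->
    exists N, forall k, (N <= k)%N -> dotv (u k - w) (u k - w) < e.
Proof.
move=> [w0 Gw0]; have [q0 q1] := andP q01.
have [c c0 Hlow] := posdefmx_coercive pH.
have [C C0 Hup] := symmetric_bound pH.1.
have step_small : forall e, 0 < e ->
    exists N, forall k, (N <= k)%N -> sqnH (step k.+1) < e.
  move=> e e0; have q2 : 0 < 1 - 2 * q by lra.
  have Dge k : 0 <= (1 - 2 * q) * sqnH (step k.+1) by rewrite mulr_ge0 // ltW.
  have [N hN] := nonincreasing_gap (lyap_ge0 w0) Dge
    (fun k => lyap_descent k Gw0) (mulr_gt0 q2 e0).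
  by exists N => k /hN; rewrite ltr_pM2l.
have [|w clw] := @bounded_cluster _ _ (fun k => u k.+2) w0 (c * (2 * lyap w0 0%N)).
  move=> k; apply: le_trans (Hlow _) _; rewrite ler_wpM2l ?(ltW c0) // -/(sqnH _).
  have := lyap_lower w0 k.+1; have := lyap_nincr 0 k.+1 Gw0; rewrite add0n.
  have := sqnH_ge0 (u k.+2 - w0); nra.
have Gw : G w 0.
  apply: Gclosed => e e0.
  have [C1 C10 hM] := mulmx_bound M; have [C2 C20 hH] := mulmx_bound H.
  (* Bounds the squared residual by the [H]-norms of the last two steps. *)
  pose K := 4 * (2 * C1 + C2) * c; have K0 : 0 < K by rewrite /K !mulr_gt0 //; lra.
  have [N hN] := step_small (e / K) (divr_gt0 e0 K0).
  have [k Nk kw] := clw e e0 N.+1.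
  exists (u k.+2); eexists; split; [exact: uG|exact: kw|].
  rewrite subr0 -/(step k) -/(step k.+1).
  case: k Nk {kw} => // k; rewrite ltnS => Nk.
  have := hN k Nk; have := hN k.+1 (leqW Nk); rewrite !ltr_pdivlMr //.
  have := Hlow (step k.+1); have := Hlow (step k.+2); rewrite -/(sqnH _) -/(sqnH _).
  move: (step k.+1) (step k.+2) => p r hr hp nr np.
  have s1 := dotvD_sqr_le (M *m r - M *m p) (- (H *m r)).
  have s2 := dotvD_sqr_le (M *m r) (- (M *m p)).
  rewrite (dotvNl (H *m r)) (dotvNr _ (H *m r)) opprK in s1.
  rewrite (dotvNl (M *m p)) (dotvNr _ (M *m p)) opprK in s2.
  have {s1 s2} s : dotv (M *m r - M *m p - H *m r) (M *m r - M *m p - H *m r) <=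
      4 * (C1 * dotv r r + C1 * dotv p p) + 2 * (C2 * dotv r r).
    have := hM r; have := hM p; have := hH r; lra.
  apply: le_lt_trans s _.
  have a1 : C1 * dotv r r <= C1 * (c * sqnH r) by rewrite ler_wpM2l // ltW.
  have a2 : C1 * dotv p p <= C1 * (c * sqnH p) by rewrite ler_wpM2l // ltW.
  have a3 : C2 * dotv r r <= C2 * (c * sqnH r) by rewrite ler_wpM2l // ltW.
  have b1 : 0 <= C1 * (c * sqnH r) by rewrite !mulr_ge0 // ltW.
  have b2 : 0 <= C1 * (c * sqnH p) by rewrite !mulr_ge0 // ltW.
  have b3 : 0 <= C2 * (c * sqnH r) by rewrite !mulr_ge0 // ltW.
  have b4 : 0 <= C2 * (c * sqnH p) by rewrite !mulr_ge0 // ltW.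
  rewrite /K in nr np; lra.
exists w; split => // e e0.
pose eta := e / (4 * c); have eta0 : 0 < eta by rewrite divr_gt0 // mulr_gt0.
have [N hN] := step_small _ eta0.
have C40 : 0 < 4 * C by rewrite mulr_gt0.
have [k Nk kw] := clw (eta / (4 * C)) (divr_gt0 eta0 C40) N.
have Lk : lyap w k.+1 < 2 * eta.
  apply: le_lt_trans (lyap_upper _ _) _; have := hN _ Nk; have := Hup (u k.+2 - w).
  move: kw; rewrite ltr_pdivlMr ?mulr_gt0 // -/(sqnH _); lra.
exists k.+2 => -[//|j]; rewrite ltnS => kj.
have := lyap_nincr k.+1 (j - k.+1) Gw; rewrite subnKC // => Lj.
apply: le_lt_trans (Hlow _) _.
have := lyap_lower w j; have := sqnH_ge0 (u j.+1 - w); rewrite -/(sqnH _) => h0 hl.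
have hj : sqnH (u j.+1 - w) < 4 * eta by nra.
rewrite (_ : e = c * (4 * eta)); first by rewrite ltr_pM2l.
by rewrite /eta; field; rewrite lt0r_neq0.
Qed.

End ReflectedIteration.

(** * The optimality system and the fixed points of T o E *)

Section Splitting.
Context {R : realType} {s m : nat} {n_ : 'I_s -> nat}.
Local Notation N := (\sum_(i < s) n_ i)%N.
Variable f : forall i : 'I_s, 'cV[R]_(n_ i) -> \bar R.
Variable A_ : forall i : 'I_s, 'M[R]_(m, n_ i).
Arguments f : clear implicits.
Arguments A_ : clear implicits.
Variables (b : 'cV[R]_m) (alpha : 'I_s -> R) (beta : R).
Hypothesis f_Gamma0 : forall i, Gamma0 (f i).
Hypothesis alpha_gt0 : forall i, 0 < alpha i.
Hypothesis beta_gt0 : 0 < beta.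
Local Notation A := (Amx A_).
Local Notation Rinv := (invmx (Rmx n_ m alpha beta)).

(** Optimality system perturbed by [g]: the graph of the monotone operator
    whose zeros are the primal-dual solutions. *)
Definition kkt (v g : 'cV[R]_(N + m)) : Prop :=
  subgradient (sumf f) (usubmx v) (usubmx g - A^T *m dsubmx v) /\
  A *m usubmx v + dsubmx g = b.

Definition kkt_skew : 'M[R]_(N + m) := block_mx 0 (- A^T) A 0.

Lemma feasibleE x : feasible A_ b x <-> A *m x = b.
Proof. by rewrite /feasible -mul_mxrow_mxcol submxcolK. Qed.

(** The coupling terms [<A^T y, x>] and [<y, A x>] cancel, which leaves the
    monotonicity of subgradients. *)
Lemma kkt_monotone v w g h : kkt v g -> kkt w h -> 0 <= dotv (g - h) (v - w).
Proof.
move=> [sv cv] [sw cw].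
have := subgradient_monotone (sumf_proper f_Gamma0) sv sw.
rewrite (dotv_split (g - h)) !usubmxB !dsubmxB.
have -> : dsubmx g - dsubmx h = - (A *m (usubmx v - usubmx w)).
  rewrite mulmxBr; apply/eqP; rewrite -subr_eq0 opprK; apply/eqP.
  have := cv; rewrite -{}cw => /eqP; rewrite -subr_eq0 => /eqP <-.
  by apply/colP => i; rewrite !mxE; ring.
have -> : usubmx g - A^T *m dsubmx v - (usubmx h - A^T *m dsubmx w) =
  (usubmx g - usubmx h) - A^T *m (dsubmx v - dsubmx w).
  by rewrite mulmxBr; apply/colP => i; rewrite !mxE; ring.
rewrite dotvDl !dotvNl dotv_mulmxl trmxK (dotvC (A *m _)) //.
Qed.

(** Closedness is inherited from each block [f i], the other operations being
    bounded linear maps. *)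
Lemma kkt_closed v g :
  (forall e, 0 < e -> exists w h, [/\ kkt w h,
     dotv (w - v) (w - v) < e & dotv (h - g) (h - g) < e]) -> kkt v g.
Proof.
move=> near.
have [C1 C10 hA] := mulmx_bound A^T; have [C2 C20 hA'] := mulmx_bound A.
split.
  apply/(subgradient_sumf f_Gamma0) => i; have [pf lf _] := f_Gamma0 i.
  apply: subgradient_closed => // e e0.
  have D0 : 0 < 2 * (1 + C1) by lra.
  have [|w [h [[sw _] wv hg]]] := near (Num.min e (e / (2 * (1 + C1)))).
    by rewrite lt_min e0 divr_gt0.
  move: wv hg; rewrite !lt_min !ltr_pdivlMr // => /andP[wv wv'] /andP[_ hg].
  exists (submxcol (usubmx w) i), (submxcol (usubmx h - A^T *m dsubmx w) i).
  split; first exact: (subgradient_sumf f_Gamma0 _ _).1.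
    rewrite -submxcolB -usubmxB; apply: le_lt_trans wv.
    exact: le_trans (dotv_submxcol _ _) (dotv_usubmx _).
  rewrite -submxcolB; apply: le_lt_trans (dotv_submxcol _ _) _.
  have -> : usubmx h - A^T *m dsubmx w - (usubmx g - A^T *m dsubmx v) =
      usubmx (h - g) + - (A^T *m dsubmx (w - v)).
    by rewrite usubmxB dsubmxB mulmxBr; apply/colP => j; rewrite !mxE; ring.
  apply: le_lt_trans (dotvD_sqr_le _ _) _; rewrite dotvNl dotvNr opprK.
  have := hA (dsubmx (w - v)); have := dotv_usubmx (h - g).
  have := ler_wpM2l (ltW C10) (dotv_dsubmx (w - v)).
  have := dotv_ge0 (h - g); have := dotv_ge0 (w - v); nra.
apply/eqP; rewrite -subr_eq0 -dotv_eq0 eq_le dotv_ge0 andbT leNgt.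
apply/negP; set r := _ - b => r0.
have D0 : 0 < 2 * (1 + C2) by lra.
have [|w [h [[_ cw] wv hg]]] := near (dotv r r / (2 * (1 + C2))).
  by rewrite divr_gt0.
move: wv hg; rewrite !ltr_pdivlMr // => wv hg.
have rE : r = - (A *m usubmx (w - v)) + - dsubmx (h - g).
  by rewrite /r -cw usubmxB dsubmxB mulmxBr; apply/colP => j; rewrite !mxE; ring.
have := dotvD_sqr_le (- (A *m usubmx (w - v))) (- dsubmx (h - g)).
rewrite -rE !dotvNl !dotvNr !opprK.
have := hA' (usubmx (w - v)); have := dotv_dsubmx (h - g).
have := ler_wpM2l (ltW C20) (dotv_usubmx (w - v)).
have := dotv_ge0 (h - g); have := dotv_ge0 (w - v); nra.
Qed.

(** The dual variable is the opposite of the multiplier. *)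
Lemma kkt_exists : (exists x, is_solution f A_ b x) ->
  [set A *m x | x in relint (effdom (sumf f))] b -> exists w, kkt w 0.
Proof.
move=> [x [/feasibleE Ax xmin]] qual.
have [|y sy] := exists_multiplier (sumf_proper f_Gamma0)
    (sumf_convex f_Gamma0) qual Ax.
  by move=> z /feasibleE; exact: xmin.
exists (col_mx x (- y)); split; rewrite !linear0 col_mxKu.
  by rewrite col_mxKd sub0r mulmxN opprK.
by rewrite addr0.
Qed.

Lemma kkt_solution w : kkt w 0 -> is_solution f A_ b (usubmx w).
Proof.
move=> [sw]; rewrite !linear0 addr0 => Ax; split; first exact/feasibleE.
move=> z /feasibleE Az; have := sw z.
rewrite linear0 sub0r dotvNl dotv_mulmxl trmxK mulmxBr Az Ax subrr dotv0r.
by rewrite oppr0 adde0.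
Qed.

Let mul_mxdiag_scalar p (c : 'I_s -> R) (X : 'M[R]_(N, p)) :
  \mxdiag_(i < s) ((c i)%:M : 'M[R]_(n_ i)) *m X = \mxcol_i (c i *: submxcol X i).
Proof.
rewrite -{1}[X]submxcolK mul_mxdiag_mxcol.
by apply: eq_mxcol => i; rewrite mul_scalar_mx.
Qed.

Let ratio_neq0 i : alpha i != 0 /\ beta != 0.
Proof. by split; apply: lt0r_neq0. Qed.

Let Pmx_mulr :
  Pmx n_ alpha beta *m \mxdiag_(i < s) ((alpha i / beta)%:M : 'M[R]_(n_ i)) = 1%:M.
Proof.
rewrite -[X in _ *m X]mulmx1 /Pmx !mul_mxdiag_scalar -[RHS]submxcolK.
apply: eq_mxcol => i; rewrite mxcolK scalerA; have [a0 b0] := ratio_neq0 i.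
by rewrite (_ : _ * _ = 1) ?scale1r //; field; rewrite a0 b0.
Qed.

Let Pmx_unit : Pmx n_ alpha beta \in unitmx.
Proof. by have [] := mulmx1_unit Pmx_mulr. Qed.

Let invmx_Pmx :
  invmx (Pmx n_ alpha beta) = \mxdiag_(i < s) ((alpha i / beta)%:M : 'M[R]_(n_ i)).
Proof. by rewrite -[RHS](mulKmx Pmx_unit) Pmx_mulr mulmx1. Qed.

Let invmx_Rmx : Rinv = block_mx (invmx (Pmx n_ alpha beta)) 0 0 beta%:M.
Proof.
set D := block_mx _ _ _ _.
have RD : Rmx n_ m alpha beta *m D = 1%:M.
  rewrite /Rmx /D mulmx_block !mulmx0 !mul0mx !addr0 !add0r -scalar_mxM.
  by rewrite mulVf ?lt0r_neq0 // mulmxV // -scalar_mx_block.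
by have [uR _] := mulmx1_unit RD; rewrite -[RHS](mulKmx uR) RD mulmx1.
Qed.

Lemma EmxE : Emx A_ alpha beta = 1%:M + Rinv *m kkt_skew.
Proof.
rewrite invmx_Rmx /kkt_skew /Emx mulmx_block !mulmx0 !mul0mx !addr0 !add0r.
by rewrite mulmxN mul_scalar_mx scalar_mx_block add_block_mx !addr0 !add0r.
Qed.

(** Each proximity operator inverts the subdifferential of its scaled function,
    and the scalings are exactly the diagonal blocks of [R^-1]. *)
Lemma Tmap_fixed w g :
  Tmap f b alpha beta (w + Rinv *m (kkt_skew *m w + g)) = w <-> kkt w g.
Proof.
set h := kkt_skew *m w + g.
have hu : usubmx h = usubmx g - A^T *m dsubmx w.
  rewrite /h /kkt_skew -[w in _ *m w]vsubmxK -[g in _ + g]vsubmxK.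
  by rewrite mul_block_col add_col_mx col_mxKu mul0mx add0r mulNmx addrC.
have hd : dsubmx h = A *m usubmx w + dsubmx g.
  rewrite /h /kkt_skew -[w in _ *m w]vsubmxK -[g in _ + g]vsubmxK.
  by rewrite mul_block_col add_col_mx col_mxKd mul0mx addr0.
have -> : w + Rinv *m h =
    col_mx (usubmx w + \mxcol_i (alpha i / beta *: submxcol (usubmx h) i))
           (dsubmx w + beta *: dsubmx h).
  rewrite -{1}[w]vsubmxK -{1}[h]vsubmxK invmx_Rmx mul_block_col !mul0mx addr0 add0r.
  by rewrite add_col_mx mul_scalar_mx invmx_Pmx mul_mxdiag_scalar.
rewrite /kkt -hu -hd /Tmap col_mxKu col_mxKd.
rewrite -(prox_conj_indicator_fixed b (dsubmx w) (dsubmx h) beta_gt0).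
rewrite (subgradient_sumf f_Gamma0).
have block i : prox (fun x => ((alpha i / beta)%:E * f i x)%E)
     (submxcol (usubmx w + \mxcol_i (alpha i / beta *: submxcol (usubmx h) i)) i)
     = submxcol (usubmx w) i <->
     subgradient (f i) (submxcol (usubmx w) i) (submxcol (usubmx h) i).
  rewrite submxcolD mxcolK; apply: prox_fixed; first exact: f_Gamma0.
  by rewrite divr_gt0.
split=> [e|[sg pd]].
  split=> [i|]; last by move/(congr1 dsubmx): e; rewrite col_mxKd.
  apply/block; move/(congr1 usubmx): e; rewrite col_mxKu.
  by move/(congr1 (fun x => submxcol x i)); rewrite mxcolK.
rewrite pd -[RHS]vsubmxK; congr col_mx; rewrite -[RHS]submxcolK.
by apply: eq_mxcol => i; apply/block.
Qed.

Lemma Emx_fixed w : Tmap f b alpha beta (Emx A_ alpha beta *m w) = w <-> kkt w 0.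
Proof. by rewrite -Tmap_fixed addr0 EmxE mulmxDl mul1mx mulmxA. Qed.

(** The residual is the step measured by [H = M0 + M2], corrected by the change of
    [M2] times the step; this is where [M0 = M1 + M2] enters. *)
Lemma iteration_kkt (M0 M1 M2 : 'M[R]_(N + m)) v0 v1 v2 : M0 = M1 + M2 ->
  v2 = Tmap f b alpha beta
         ((Emx A_ alpha beta - Rinv *m M0) *m v2
          + Rinv *m M1 *m v1 + Rinv *m M2 *m v0) ->
  kkt v2 (M2 *m (v2 - v1) - M2 *m (v1 - v0) - (M0 + M2) *m (v2 - v1)).
Proof.
move=> M0E v2E; apply/Tmap_fixed/esym; rewrite {1}v2E; congr (Tmap _ _ _ _ _).
rewrite EmxE mulmxBl mulmxDl mul1mx -!mulmxA -!addrA; congr (_ + _).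
rewrite -mulmxN -!mulmxDr; congr (_ *m _); congr (_ + _).
rewrite {}M0E !mulmxDl !mulmxBr; apply/colP => i; rewrite !mxE; ring.
Qed.

End Splitting.

Theorem theorem4p5 (R : realType) (s m : nat) (n_ : 'I_s -> nat)
    (s_gt0 : (0 < s)%N) (m_gt0 : (0 < m)%N)
    (n_gt0 : forall i : 'I_s, (0 < n_ i)%N)
    (f : forall i : 'I_s, 'cV[R]_(n_ i) -> \bar R)
    (A_ : forall i : 'I_s, 'M[R]_(m, n_ i)) (b : 'cV[R]_m)
    (alpha : 'I_s -> R) (beta : R)
    (f_Gamma0 : forall i : 'I_s, Gamma0 (f i))
    (alpha_gt0 : forall i : 'I_s, 0 < alpha i) (beta_gt0 : 0 < beta)
    (solvable : exists x : 'cV[R]_(\sum_(i < s) n_ i)%N,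
       is_solution f A_ b x)
    (qualification :
       [set Amx A_ *m x | x in relint (effdom (sumf f))] b)
    (M0 M1 M2 : 'M[R]_(\sum_(i < s) n_ i + m)%N)
    (TM_wd : TM_well_defined f A_ b alpha beta M0 M1 M2)
    (v0 v1 : 'cV[R]_(\sum_(i < s) n_ i + m)%N)
    (v : nat -> 'cV[R]_(\sum_(i < s) n_ i + m)%N)
    (v_0 : v 0%N = v0) (v_1 : v 1%N = v1)
    (v_rec : forall k : nat, (1 <= k)%N ->
       v k.+1 =
       Tmap f b alpha beta
         ((Emx A_ alpha beta - invmx (Rmx n_ m alpha beta) *m M0) *m v k.+1
          + invmx (Rmx n_ m alpha beta) *m M1 *m v k
          + invmx (Rmx n_ m alpha beta) *m M2 *m v k.-1))
    (cond_M : condition_M M0 M1 M2) :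
  (exists w : 'cV[R]_(\sum_(i < s) n_ i + m)%N,
     Tmap f b alpha beta (Emx A_ alpha beta *m w) = w /\
     (fun k : nat => v k) @ \oo --> w) /\
  (exists x : 'cV[R]_(\sum_(i < s) n_ i)%N,
     is_solution f A_ b x /\
     (fun k : nat => usubmx (v k)) @ \oo --> x).
Proof.
have [M0E pH nq] := cond_M.
(* A number strictly between the spectral norm and 1/2, positive even when
   [M2 = 0]. *)
pose nu := spectral_norm (invsqrtmx (M0 + M2) *m M2 *m invsqrtmx (M0 + M2)).
have nu0 : 0 <= nu by exact: spectral_norm_ge0.
have {}nq : nu < 2^-1 by [].
(* The midpoint of [nu] and 1/2 is positive even when [nu = 0], as the scaling in
   Young's inequality requires. *)
pose q := (nu + 2^-1) / 2.
have nuq : nu <= q by rewrite /q; lra.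
have q0 : 0 < q by rewrite /q; lra.
have q1 : 0 < q < 2^-1 by rewrite q0 /q /=; lra.
have [w [kw vw]] : exists w, kkt f A_ b w 0 /\ forall e, 0 < e ->
    exists N, forall k, (N <= k)%N -> dotv (v k - w) (v k - w) < e.
  apply: (reflected_iteration_converges pH q1).
  - exact: spectral_bilinear_bound pH q0 nuq.
  - by move=> *; apply: (kkt_monotone f_Gamma0); eassumption.
  - by move=> *; exact: (kkt_closed f_Gamma0).
  - by move=> k; apply: (iteration_kkt f_Gamma0 alpha_gt0 beta_gt0 M0E); exact: v_rec.
  - exact: kkt_exists.
split; first by exists w; split; [apply/Emx_fixed|exact: dotv_cvg].
exists (usubmx w); split; first exact: kkt_solution.
apply: dotv_cvg => e /vw[N hN]; exists N => k /hN; apply: le_lt_trans.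
by rewrite -usubmxB dotv_usubmx.
Qed.
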